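(* Let $b\in[\mathbb H^\infty_d]_1$ be non-column-extreme, let $X_k:=L_k^*|_{\mathscr H^{\mathrm t}(b)}$, $X:=(X_1,\dots,X_d)$, and let $\boldsymbol b:=L^*b^{\mathrm t}=(L_k^*b^{\mathrm t})_{k}\in\mathscr H^{\mathrm t}(b)\otimes\mathbb C^d$. Define a formal power series $a(\mathfrak z)=\sum_{\omega\in\mathbb F^d}\hat a_\omega\mathfrak z^\omega$ by letting $a(0)=\hat a_\emptyset>0$ be the positive number with $$a(0)^2:=1-|b(0)|^2-\|\boldsymbol b\|^2_{\mathscr H^{\mathrm t}(b)\otimes\mathbb C^d}>0,\qquad \hat a_\omega:=-a(0)\,\langle b^{\mathrm t},X^\omega b^{\mathrm t}\rangle_{\mathscr H^{\mathrm t}(b)}\quad(\omega\neq\emptyset).$$ Then $a\in[\mathbb H^\infty_d]_1$, $a$ is outer, and $a(R)^*a(R)$ is the maximal factorable left Toeplitz minorant of $I-b(R)^*b(R)$, so that $c:=\begin{pmatrix} b \\ a \end{pmatrix}$ is column-extreme, and $$a(0)^2=\inf_{p\in\mathbb C\{\mathfrak z\}_0}\big\langle 1-p,\,(I-b(R)^*b(R))(1-p)\big\rangle_{\mathbb H^2_d}.$$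
   Context: Fix $d\in\mathbb N\cup\{\infty\}$. $\mathbb F^d$ is the free monoid of words in the letters $1,\dots,d$ with unit the empty word $\emptyset$; $|\omega|$ is the length of $\omega$ and $\omega^{\mathrm t}$ the reversed word. For $\omega=i_1\cdots i_n$ and operators $T_1,\dots,T_d$, $T^\omega:=T_{i_1}\cdots T_{i_n}$, $T^\emptyset:=I$. $\mathbb H^2_d$ (full Fock space) is the Hilbert space of formal power series $h=\sum_\omega\hat h_\omega\mathfrak z^\omega$ in non-commuting variables $\mathfrak z_1,\dots,\mathfrak z_d$ with $\sum|\hat h_\omega|^2<\infty$ and orthonormal basis $\{\mathfrak z^\omega\}$; $1:=\mathfrak z^\emptyset$, $h(0):=\hat h_\emptyset$. Inner products are conjugate-linear in the first argument. $h^{\mathrm t}:=\sum\hat h_\omega\mathfrak z^{\omega^{\mathrm t}}$ and $U_{\mathrm t}h:=h^{\mathrm t}$ (a unitary). $L_k$, $R_k$ are left and right multiplication by $\mathfrak z_k$ on $\mathbb H^2_d$. $\mathbb H^\infty_d$ is the algebra of power series $F$ such that left multiplication $F(L):h\mapsto Fh$ is bounded on $\mathbb H^2_d$, with the operator norm; $[\mathbb H^\infty_d]_1$ is its closed unit ball; $F(R):=U_{\mathrm t}F(L)U_{\mathrm t}$, which is right multiplication by $F^{\mathrm t}$. $F$ is outer if $F(R)$ (equivalently $F(L)$) has dense range. $\mathbb C\{\mathfrak z\}_0$ is the set of free polynomials with zero constant term. An element $b\in[\mathbb H^\infty_d]_1$ is column-extreme (CE) if there is no non-zero $e\in\mathbb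 H^\infty_d$ such that the column $\begin{pmatrix} b(L) \\ e(L) \end{pmatrix}:\mathbb H^2_d\to\mathbb H^2_d\otimes\mathbb C^2$ is a contraction. A contractive column $c\in\mathbb H^\infty_d\otimes\mathbb C^2$ is CE if there is no non-zero $e\in\mathbb H^\infty_d\otimes\mathbb C^2$ such that the column $\begin{pmatrix} c \\ e \end{pmatrix}$ is contractive. The right free de Branges–Rovnyak space $\mathscr H^{\mathrm t}(b)$ is $\mathrm{Ran}\sqrt{I-b(R)b(R)^*}\subseteq\mathbb H^2_d$ with the Hilbert norm making $\sqrt{I-b(R)b(R)^*}$ a co-isometry onto it. It is known that $\mathscr H^{\mathrm t}(b)$ is invariant under each $L_k^*$, that $L_k^*b^{\mathrm t}\in\mathscr H^{\mathrm t}(b)$, and that $b^{\mathrm t}\in\mathscr H^{\mathrm t}(b)$ when $b$ is non-CE. A bounded operator $T$ on $\mathbb H^2_d$ is left Toeplitz if $L_j^*TL_k=\delta_{j,k}T$. A factorable (left Toeplitz) minorant of $T\ge0$ is an operator $h(R)^*h(R)\le T$ with $h\in\mathbb H^\infty_d$ outer; it is the maximal factorable minorant if it dominates every other factorable minorant of $T$. *)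

(* Defs.v *)
From HB Require Import structures.
From mathcomp Require Import all_boot all_order all_algebra.
From mathcomp Require Import complex ring.
From mathcomp Require Import all_classical all_reals all_analysis.

Set Implicit Arguments.
Unset Strict Implicit.
Unset Printing Implicit Defensive.
Import Order.TTheory GRing.Theory Num.Theory.
Import Normc.

Local Open Scope classical_set_scope.
Local Open Scope ring_scope.
Local Open Scope complex_scope.

(* d = Some n stands for n letters, d = None for countably many (d = oo). *)
Definition letter (d : option nat) : countType :=
  match d return countType with Some n => 'I_n | None => nat end.

Notation word d := (seq (letter d)).

(* Formal power series in non-commuting variables, as coefficient families. *)
Notation fseries R d := (seq (letter d) -> R[i]).

Definition sqnorm (R : realType) (d : option nat) (h : fseries R d) : \bar R :=
  \esum_(w in [set: word d]) (normc (h w) ^+ 2)%:E.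

Definition square_summable (R : realType) (d : option nat) : {pred fseries R d} :=
  fun h => `[< (sqnorm h < +oo)%E >].

Lemma square_summable_submod (R : realType) (d : option nat) :
  submod_closed (@square_summable R d).
Proof.
split.
  apply/asboolP; rewrite /sqnorm esum1 ?ltry// => w _.
  by rewrite normc0 expr0n.
move=> c f g /asboolP f2 /asboolP g2; apply/asboolP.
have nc_ge0 (z : R[i]) : 0 <= normc z by case: z => x y; exact: sqrtr_ge0.
have K0 : 0 <= 2 * normc c ^+ 2 by rewrite mulr_ge0 ?exprn_ge0.
have le_pt w : normc ((c *: f + g) w) ^+ 2 <=
    2 * normc c ^+ 2 * normc (f w) ^+ 2 + 2 * normc (g w) ^+ 2.
  have -> : (c *: f + g) w = c * f w + g w by [].
  apply: (@le_trans _ _ ((normc (c * f w) + normc (g w)) ^+ 2)).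
    by rewrite ler_sqr ?nnegrE ?addr_ge0 ?nc_ge0 ?le_normcD.
  rewrite normcM -mulrA -exprMn -mulrDr; set x := _ * _; set y := normc _.
  by rewrite -subr_ge0 (_ : _ - _ = (x - y) ^+ 2) ?sqr_ge0//; ring.
have scale (K : R) (h : fseries R d) : 0 <= K -> (sqnorm h < +oo)%E ->
    (\esum_(w in [set: word d]) (K * normc (h w) ^+ 2)%:E < +oo)%E.
  move=> K_ge0 h2; apply: (@le_lt_trans _ _ (K%:E * sqnorm h)%E); last first.
    by rewrite lte_mul_pinfty ?lee_fin.
  apply: ge_ereal_sup => _ /= [X [finX _] <-].
  under eq_fsbigr do rewrite EFinM.
  rewrite -ge0_mule_fsumr; last by move=> w; rewrite lee_fin exprn_ge0 ?nc_ge0.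
  rewrite lee_wpmul2l ?lee_fin//; apply: ereal_sup_ubound.
  by exists X.
have := lte_add_pinfty (scale _ _ K0 f2) (scale 2 _ (ler0n _ _) g2).
apply: le_lt_trans; rewrite -esumD; first last.
- by move=> w _; rewrite lee_fin mulr_ge0 ?exprn_ge0 ?nc_ge0.
- by move=> w _; rewrite lee_fin mulr_ge0 ?exprn_ge0 ?nc_ge0.
by apply: le_esum => w _; rewrite -EFinD lee_fin.
Qed.

HB.instance Definition _ (R : realType) (d : option nat) :=
  GRing.isSubmodClosed.Build R[i] (fseries R d) (@square_summable R d)
    (@square_summable_submod R d).

(* The full Fock space H^2_d. *)
Record fock (R : realType) (d : option nat) :=
  Fock { coef :> fseries R d; _ : coef \in @square_summable R d }.

HB.instance Definition _ (R : realType) (d : option nat) :=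
  [isSub for @coef R d].
HB.instance Definition _ (R : realType) (d : option nat) :=
  [Choice of fock R d by <:].
HB.instance Definition _ (R : realType) (d : option nat) :=
  [SubChoice_isSubLmodule of fock R d by <:].

Definition fnorm (R : realType) (d : option nat) (h : fock R d) : R :=
  Num.sqrt (fine (sqnorm h)).

(* Sum of an absolutely summable family of reals, resp. of complex numbers. *)
Definition rsum (R : realType) (T : choiceType) (f : T -> R) : R :=
  let F := fun x => (f x)%:E in
  fine (\esum_(x in [set: T]) (F^\+%E x)) -
  fine (\esum_(x in [set: T]) (F^\-%E x)).

Definition csum (R : realType) (T : choiceType) (f : T -> R[i]) : R[i] :=
  rsum (fun x => complex.Re (f x)) +i* rsum (fun x => complex.Im (f x)).

(* Conjugate-linear in the first argument. *)
Definition inner (R : realType) (d : option nat) (f g : fock R d) : R[i] :=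
  csum (fun w => conjc (f w) * g w).

Definition bounded_op (R : realType) (d : option nat)
    (T : fock R d -> fock R d) : Prop :=
  linear T /\ exists M : R, forall h, fnorm (T h) <= M * fnorm h.

(* The adjoint, which exists and is unique when T is bounded. *)
Definition adj (R : realType) (d : option nat)
    (T : fock R d -> fock R d) : fock R d -> fock R d :=
  xget (fun=> 0) [set S | forall f g, inner (S f) g = inner f (T g)].

(* In the order of R[i], 0 <= z says that z is real and nonnegative. *)
Definition positive_op (R : realType) (d : option nat)
    (T : fock R d -> fock R d) : Prop :=
  bounded_op T /\ forall h, 0 <= inner h (T h).

Definition op_le (R : realType) (d : option nat)
    (S T : fock R d -> fock R d) : Prop :=
  forall h, inner h (S h) <= inner h (T h).

(* The positive square root, which exists and is unique when T is positive. *)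
Definition sqrt_op (R : realType) (d : option nat)
    (T : fock R d -> fock R d) : fock R d -> fock R d :=
  xget (fun=> 0) [set S | positive_op S /\ S \o S = T].

Definition word_op (R : realType) (d : option nat)
    (T : letter d -> fock R d -> fock R d) (w : word d) : fock R d -> fock R d :=
  foldr (fun k S => T k \o S) idfun w.

Definition monomial (R : realType) (d : option nat) (w : word d) : fseries R d :=
  fun v => (v == w)%:R.

Definition smul (R : realType) (d : option nat) (F G : fseries R d) :
    fseries R d :=
  fun w => \sum_(k < (size w).+1) F (take k w) * G (drop k w).

Definition transpose (R : realType) (d : option nat) (F : fseries R d) :
    fseries R d :=
  fun w => F (rev w).

(* The element of the Fock space with the given coefficients; 0 if they are not
   square-summable. *)
Definition to_fock (R : realType) (d : option nat) (h : fseries R d) : fock R d :=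
  insubd 0 h.

Definition Ut (R : realType) (d : option nat) (h : fock R d) : fock R d :=
  to_fock (transpose h).

(* F(L) and F(R) = U_t F(L) U_t. *)
Definition lmul (R : realType) (d : option nat) (F : fseries R d) :
    fock R d -> fock R d :=
  fun h => to_fock (smul F h).

Definition rmul (R : realType) (d : option nat) (F : fseries R d) :
    fock R d -> fock R d :=
  @Ut R d \o lmul F \o @Ut R d.

Definition shift (R : realType) (d : option nat) (k : letter d) :
    fock R d -> fock R d :=
  lmul (@monomial R d [:: k]).

(* F is in H^oo_d. *)
Definition multiplier (R : realType) (d : option nat) (F : fseries R d) : Prop :=
  (forall h : fock R d, smul F h \in @square_summable R d) /\
  bounded_op (lmul F).

(* F is in the closed unit ball of H^oo_d. *)
Definition unit_ball (R : realType) (d : option nat) (F : fseries R d) : Prop :=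
  multiplier F /\ forall h, fnorm (lmul F h) <= fnorm h.

Definition outer (R : realType) (d : option nat) (F : fseries R d) : Prop :=
  multiplier F /\
  forall (f : fock R d) (eps : R), 0 < eps ->
    exists h, fnorm (f - rmul F h) < eps.

Definition column_multiplier (R : realType) (d : option nat) (m : nat)
    (c : 'cV[fseries R d]_m) : Prop :=
  forall i, multiplier (c i 0).

Definition column_contractive (R : realType) (d : option nat) (m : nat)
    (c : 'cV[fseries R d]_m) : Prop :=
  forall h, \sum_i fnorm (lmul (c i 0) h) ^+ 2 <= fnorm h ^+ 2.

(* A single element b of H^oo_d is the column const_mx b with m = 1. *)
Definition column_extreme (R : realType) (d : option nat) (m : nat)
    (c : 'cV[fseries R d]_m) : Prop :=
  [/\ column_multiplier c, column_contractive c &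
      ~ exists e : 'cV[fseries R d]_m,
          [/\ e <> 0, column_multiplier e & column_contractive (col_mx c e)]].

(* The square root D of I - b(R) b(R)^*. The space H^t(b) is its range. *)
Definition dBR_sqrt (R : realType) (d : option nat) (b : fseries R d) :
    fock R d -> fock R d :=
  sqrt_op (fun h => h - rmul b (adj (rmul b) h)).

(* For f in H^t(b), the g with f = D g that is orthogonal to the kernel of D:
   since D is a co-isometry onto H^t(b), f and g have the same norm. *)
Definition dBR_lift (R : realType) (d : option nat) (b : fseries R d)
    (f : fock R d) : fock R d :=
  xget 0 [set g | dBR_sqrt b g = f /\
                  forall k, dBR_sqrt b k = 0 -> inner k g = 0].

Definition dBR_inner (R : realType) (d : option nat) (b : fseries R d)
    (f g : fock R d) : R[i] :=
  inner (dBR_lift b f) (dBR_lift b g).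

Definition dBR_norm (R : realType) (d : option nat) (b : fseries R d)
    (f : fock R d) : R :=
  fnorm (dBR_lift b f).

(* 1 - |b(0)|^2 - ||L^* b^t||^2. For infinite d the last term is a series, which
   is summed in the extended reals. *)
Definition companion0_sq (R : realType) (d : option nat) (b : fseries R d) :
    \bar R :=
  (1 - (normc (b [::]) ^+ 2)%:E -
   \esum_(k in [set: letter d])
     (dBR_norm b (adj (@shift R d k) (to_fock (transpose b))) ^+ 2)%:E)%E.

(* X_k is the restriction of L_k^* to H^t(b), so X^w acts on b^t as the word w
   in the operators L_k^*. *)
Definition companion (R : realType) (d : option nat) (b : fseries R d) :
    fseries R d :=
  let a0 := (Num.sqrt (fine (companion0_sq b)))%:C in
  let bt := to_fock (transpose b) in
  fun w => if w is [::] then a0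
           else - a0 * dBR_inner b bt (word_op (fun k => adj (@shift R d k)) w bt).

Definition left_toeplitz (R : realType) (d : option nat)
    (T : fock R d -> fock R d) : Prop :=
  bounded_op T /\
  forall (j k : letter d) (h : fock R d),
    adj (@shift R d j) (T (@shift R d k h)) = (j == k)%:R *: T h.

Definition factorable_minorant (R : realType) (d : option nat)
    (T M : fock R d -> fock R d) : Prop :=
  exists h : fseries R d,
    [/\ outer h, M = adj (rmul h) \o rmul h & op_le M T].

Definition maximal_factorable_minorant (R : realType) (d : option nat)
    (T M : fock R d -> fock R d) : Prop :=
  factorable_minorant T M /\
  forall N, factorable_minorant T N -> op_le N M.

(* I - b(R)^* b(R). *)
Definition codefect (R : realType) (d : option nat) (b : fseries R d) :
    fock R d -> fock R d :=
  fun h => h - adj (rmul b) (rmul b h).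

(* p is a free polynomial with zero constant term. *)
Definition free_poly0 (R : realType) (d : option nat) (p : fock R d) : Prop :=
  finite_set [set w | p w != 0] /\ p [::] = 0.

(* Main.v *)
Require Import Defs.
From mathcomp Require Import all_boot all_order all_algebra.
From mathcomp Require Import complex ring lra.
From mathcomp Require Import all_classical all_reals all_analysis.

Set Implicit Arguments.
Unset Strict Implicit.
Unset Printing Implicit Defensive.
Import Order.TTheory GRing.Theory Num.Theory.
Import Defs Normc.
Import numFieldNormedType.Exports.

Local Open Scope classical_set_scope.
Local Open Scope ring_scope.
Local Open Scope complex_scope.

(** Write L_k for the left shifts, B = b(R), and Dl for the positive square
    root of 1 - B^* B. Since B commutes with every L_k, the operator Dl^2 is
    left Toeplitz: the maps Dl h |-> Dl L_k h extend to isometries V_k with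
    orthogonal ranges on the closure of the range of Dl. The whole proof is the
    Wold decomposition of this row isometry; Dl, V_k and the projections it
    needs come from completeness of the Fock space (psqrt, Douglas,
    projection).

    Let U be the component of Dl 1 orthogonal to all Dl p with p(0) = 0, and a0
    its norm. Then Dl U is the constant a0^2, and a0^2 is the infimum, over
    these p, of |Dl (1 - p)|^2 = <1 - p, (1 - B^* B) (1 - p)>. If b is not
    column-extreme, some nonzero e(R) satisfies |e(R) h| <= |Dl h|; its
    lowest-degree coefficients are not affected by p, so a0 > 0
    (wandering_neq0). Put u = U / a0. The closed range is the orthogonal sum of
    the line of u and the ranges of the V_k (wold_step). Iterating, the
    coefficients <V^w u, Dl h> satisfy a Bessel inequality, and they exhaust
    the norm of the vectors orthogonal to Dl r for all r of high order
    (wold_bessel, wold_parseval). As Dl u is constant, the map sending h to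
    these coefficients is right multiplication by a series (wold_coef), that is
    a(R) for some a with |a(R) h| <= |Dl h|.

    The series a is outer because a(R) q is close to the constant a0 whenever
    Dl q is close to a0 u (wold_range_orth). It is maximal because the
    low-order coefficients of e(R) h do not change when h is modified in high
    degrees; if |e(R) h| <= |Dl h| for all h, they are bounded by the distance
    from Dl h to the vectors Dl r with r of high order, and that distance is
    the norm of low-order coefficients of a(R) h (wold_maximal). The argument
    applies to columns e, and the column of a and e gives that (b, a) is
    column-extreme.

    It remains to recognize a. If B^* f = Dl x and B^* f' = Dl x' with x, x' in
    the closed range, then the inner product of f and f' in the de
    Branges-Rovnyak space is <f, f'> + <x, x'> (coisometry_innerE). For f = b^t
    = B 1 one may take x = u / a0 - Dl 1, and for f' the backward shift of b^t
    along a nonempty word w, x' is minus the backward shift of Dl 1 along w by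
    the operators V_k^*. In the sum all terms cancel except - <u, V_w^* Dl 1> /
    a0 (coisometry_inner_word), which identifies the Wold coefficients with the
    given formula for a; the same computation of norms gives the formula for
    a(0)^2 (coisometry_sum). *)

(** * Moduli of complex numbers and elementary estimates *)

Section ComplexNumbers.
Variable R : realType.
Implicit Types (x y e : R) (z t : R[i]).

Lemma normc_ge0 z : 0 <= normc z.
Proof. by case: z => x y; exact: sqrtr_ge0. Qed.

Lemma normc_sqr z : (normc z ^+ 2)%:C = conjc z * z.
Proof.
case: z => x y /=; rewrite sqr_sqrtr ?addr_ge0 ?sqr_ge0//.
by apply/eqP; rewrite eq_complex /=; apply/andP; split; apply/eqP; ring.
Qed.

Lemma normc_conj z : normc (conjc z) = normc z.
Proof. by case: z => x y /=; rewrite sqrrN. Qed.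

Lemma normc_real x : normc x%:C = `|x|.
Proof. by rewrite /= expr0n addr0 sqrtr_sqr. Qed.

Lemma le_Re_normc z : `|complex.Re z| <= normc z.
Proof. by case: z => x y /=; rewrite -sqrtr_sqr ler_wsqrtr ?lerDl ?sqr_ge0. Qed.

Lemma le_Im_normc z : `|complex.Im z| <= normc z.
Proof. by case: z => x y /=; rewrite -sqrtr_sqr ler_wsqrtr ?lerDr ?sqr_ge0. Qed.

Lemma le_normc_ReIm z : normc z <= `|complex.Re z| + `|complex.Im z|.
Proof.
case: z => x y /=; rewrite -(@ler_pXn2r _ 2)// ?nnegrE ?addr_ge0 ?sqrtr_ge0//.
rewrite sqr_sqrtr ?addr_ge0 ?sqr_ge0// sqrrD !real_normK ?num_real//.
have : 0 <= `|x| * `|y| by rewrite mulr_ge0.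
by set t := _ * _; move=> t0; rewrite mulr2n; lra.
Qed.

Lemma ReZ x z : complex.Re (x%:C * z) = x * complex.Re z.
Proof. by case: z => a b /=; rewrite mul0r subr0. Qed.

Lemma ReD z t : complex.Re (z + t) = complex.Re z + complex.Re t.
Proof. by case: z; case: t. Qed.

Lemma ReB z t : complex.Re (z - t) = complex.Re z - complex.Re t.
Proof. by case: z; case: t. Qed.

Lemma ImB z t : complex.Im (z - t) = complex.Im z - complex.Im t.
Proof. by case: z; case: t. Qed.

Lemma ge0cE z : (0 <= z) = (complex.Im z == 0) && (0 <= complex.Re z).
Proof. by case: z => x y; rewrite lecE. Qed.

Lemma conjc_realP z : complex.Im z = 0 <-> conjc z = z.
Proof. by case: z => x y /=; split=> [->|[]]; rewrite ?oppr0//; lra. Qed.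

Lemma le_of_sqr x y : 0 <= y -> x ^+ 2 <= y ^+ 2 -> x <= y.
Proof.
move=> y0; rewrite !leNgt; apply: contra => yx.
by rewrite ltr_pXn2r// nnegrE// (le_trans y0 (ltW yx)).
Qed.

Lemma le_sqr x y : 0 <= x -> x <= y -> x ^+ 2 <= y ^+ 2.
Proof.
by move=> x0 xy; rewrite ler_pXn2r// nnegrE// (le_trans x0 xy).
Qed.

Lemma le_sqr_approx x y : 0 <= y ->
  (forall e, 0 < e -> x <= (y + e) ^+ 2) -> x <= y ^+ 2.
Proof.
move=> y0 Hx; apply/ler_addgt0Pr => e e0.
pose t := Num.min 1 (e / (2 * y + 1)).
have k0 : 0 < 2 * y + 1 by rewrite ltr_wpDl ?mulr_ge0.
have t0 : 0 < t by rewrite lt_min ltr01 divr_gt0.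
apply: le_trans (Hx t t0) _; rewrite sqrrD -addrA lerD2l.
have t1 : t <= 1 by rewrite ge_min lexx.
have te : t * (2 * y + 1) <= e by rewrite -ler_pdivlMr// ge_min lexx orbT.
have tt : t ^+ 2 <= t by rewrite expr2 ger_pMr.
by apply: le_trans te; rewrite mulrDr mulr1 mulrCA mulrA mulr_natl mulrC
  -mulr_natl; lra.
Qed.

Lemma le_mul_small x y e : 0 <= x -> 0 <= y -> y <= e / (x + 1) -> x * y <= e.
Proof.
move=> x0 y0; have x1 : 0 < x + 1 by rewrite ltr_wpDl.
rewrite ler_pdivlMr// => xy; apply: le_trans xy.
by rewrite mulrC ler_wpM2l// lerDl.
Qed.

Lemma conjcD z t : conjc (z + t) = conjc z + conjc t.
Proof. exact: rmorphD. Qed.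

Lemma conjcM z t : conjc (z * t) = conjc z * conjc t.
Proof. exact: rmorphM. Qed.

Lemma conjcN z : conjc (- z) = - conjc z.
Proof. exact: rmorphN. Qed.

Lemma realcD x y : (x + y)%:C = x%:C + y%:C.
Proof. exact: rmorphD. Qed.

Lemma realcB x y : (x - y)%:C = x%:C - y%:C.
Proof. exact: rmorphB. Qed.

Lemma realcM x y : (x * y)%:C = x%:C * y%:C.
Proof. exact: rmorphM. Qed.

Lemma small_eq0 z : (forall e, 0 < e -> normc z <= e) -> z = 0.
Proof.
move=> H; apply: eq0_normc; apply/eqP; rewrite eq_le normc_ge0 andbT.
by apply/ler_addgt0Pr => e e0; rewrite add0r; exact: H.
Qed.

End ComplexNumbers.

(** * Absolutely summable families *)

Section Sums.
Variables (R : realType) (T : choiceType).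
Implicit Types (f g p q : T -> R) (s : seq T).

Lemma esum_le_seq f (M : R) : (forall x, 0 <= f x) ->
  (forall s, uniq s -> \sum_(x <- s) f x <= M) ->
  (\esum_(x in [set: T]) (f x)%:E <= M%:E)%E.
Proof.
move=> f0 H; apply: ge_ereal_sup => _ /= [X [finX _] <-].
rewrite fsbig_finite//= sumEFin lee_fin; exact: H.
Qed.

Lemma seq_le_esum f s : (forall x, 0 <= f x) -> uniq s ->
  ((\sum_(x <- s) f x)%:E <= \esum_(x in [set: T]) (f x)%:E)%E.
Proof.
move=> f0 us; apply: esum_ge; exists [set` s]; first by split.
by rewrite -sumEFin fsbig_seq.
Qed.

Lemma seq_near_esum f (e : R) : (forall x, 0 <= f x) -> 0 < e ->
  (\esum_(x in [set: T]) (f x)%:E < +oo)%E ->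
  exists2 s, uniq s &
    fine (\esum_(x in [set: T]) (f x)%:E) - e < \sum_(x <- s) f x.
Proof.
move=> f0 e0 ffin; apply: contrapT => H.
have : (\esum_(x in [set: T]) (f x)%:E <=
   (fine (\esum_(x in [set: T]) (f x)%:E) - e)%:E)%E.
  apply: esum_le_seq => // s us; rewrite leNgt; apply/negP => lt.
  by apply: H; exists s.
have fg : \esum_(x in [set: T]) (f x)%:E \is a fin_num.
  by rewrite ge0_fin_numE// esum_ge0// => x _; rewrite lee_fin.
by rewrite -{1}(fineK fg) lee_fin; lra.
Qed.

Definition summing f := (\esum_(x in [set: T]) `|f x|%:E < +oo)%E.

Lemma summing_le f g : (forall x, `|f x| <= `|g x|) -> summing g -> summing f.
Proof.
move=> fg; apply: le_lt_trans; apply: le_esum => x _; rewrite lee_fin;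
  exact: fg.
Qed.

Lemma summingD f g : summing f -> summing g -> summing (fun x => f x + g x).
Proof.
move=> ff gf; have := lte_add_pinfty ff gf; apply: le_lt_trans.
rewrite -esumD => [|x _|x _]; rewrite ?lee_fin//.
by apply: le_esum => x _; rewrite -EFinD lee_fin ler_normD.
Qed.

Lemma esumZ (c : R) f : 0 <= c -> (forall x, 0 <= f x) ->
  (\esum_(x in [set: T]) (c * f x)%:E = c%:E * \esum_(x in [set: T]) (f
    x)%:E)%E.
Proof.
move=> c0 f0; apply/eqP; rewrite eq_le; apply/andP; split.
  apply: ge_ereal_sup => _ /= [X [finX _] <-].
  under eq_fsbigr do rewrite EFinM.
  rewrite -ge0_mule_fsumr => [|x]; last by rewrite lee_fin.
  by rewrite lee_wpmul2l ?lee_fin//; apply: ereal_sup_ubound; exists X.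
have [->|cn0] := eqVneq c 0.
  by rewrite mul0e; apply: esum_ge0 => x _; rewrite mul0r.
have cp : 0 < c by rewrite lt_def cn0.
rewrite -lee_pdivlMl//; apply: ge_ereal_sup => _ /= [X [finX _] <-].
rewrite lee_pdivlMl// ge0_mule_fsumr; last by move=> x; rewrite lee_fin.
by apply: ereal_sup_ubound; exists X.
Qed.

Lemma summingZ (c : R) f : summing f -> summing (fun x => c * f x).
Proof.
rewrite /summing => ff; under eq_esum do rewrite normrM.
rewrite esumZ//; rewrite lte_mul_pinfty ?lee_fin//.
Qed.

Lemma fin_esum f : (forall x, 0 <= f x) -> summing f ->
  \esum_(x in [set: T]) (f x)%:E \is a fin_num.
Proof.
move=> f0; rewrite ge0_fin_numE; last by apply: esum_ge0 => x _;
  rewrite lee_fin.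
by apply: le_lt_trans; apply: le_esum => x _; rewrite lee_fin ler_norm.
Qed.

(** Any splitting of f as a difference of summable nonnegative families gives
    the same value; linearity of the sum follows by adding or scaling
    splittings. *)
Lemma rsum_sub f p q : (forall x, f x = p x - q x) ->
  (forall x, 0 <= p x) -> (forall x, 0 <= q x) -> summing p -> summing q ->
  rsum f = fine (\esum_(x in [set: T]) (p x)%:E)
         - fine (\esum_(x in [set: T]) (q x)%:E).
Proof.
move=> fE p0 q0 ps qs.
pose fp x := Num.max (f x) 0; pose fm x := Num.max (- f x) 0.
have posE : \esum_(x in [set: T]) ((fun x => (f x)%:E)^\+%E x) =
            \esum_(x in [set: T]) (fp x)%:E.
  by apply: eq_esum => x _; rewrite funeposE -EFin_max.
have negE : \esum_(x in [set: T]) ((fun x => (f x)%:E)^\-%E x) =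
            \esum_(x in [set: T]) (fm x)%:E.
  by apply: eq_esum => x _; rewrite funenegE -EFinN -EFin_max.
rewrite /rsum posE negE.
have fp0 x : 0 <= fp x by rewrite le_max lexx orbT.
have fm0 x : 0 <= fm x by rewrite le_max lexx orbT.
have fps : summing fp.
  apply: (summing_le _ ps) => x; rewrite !ger0_norm// ge_max p0 andbT fE.
  by rewrite lerBlDr lerDl.
have fms : summing fm.
  apply: (summing_le _ qs) => x; rewrite !ger0_norm// ge_max q0 andbT fE.
  by rewrite opprB lerBlDr lerDl.
have E : (\esum_(x in [set: T]) (fp x)%:E + \esum_(x in [set: T]) (q x)%:E =
          \esum_(x in [set: T]) (fm x)%:E + \esum_(x in [set: T]) (p x)%:E)%E.
  rewrite -!esumD; try by move=> x _; rewrite lee_fin.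
  apply: eq_esum => x _; rewrite -!EFinD; congr _%:E.
  rewrite /fp /fm; have := fE x; set y := f x => yE.
  by case: (lerP y 0) => y0; [rewrite max_l|rewrite max_r]; lra.
have := congr1 (@fine R) E; rewrite !fineD ?fin_esum//; lra.
Qed.

Lemma rsum_ge0 f : (forall x, 0 <= f x) -> summing f ->
  rsum f = fine (\esum_(x in [set: T]) (f x)%:E).
Proof.
move=> f0 fs; rewrite (@rsum_sub f f (fun=> 0))//.
- by rewrite [X in _ - fine X]esum1//= subr0.
- by move=> x; rewrite subr0.
- rewrite /summing esum1 ?ltry// => x _; by rewrite normr0.
Qed.

Let pos f x := Num.max (f x) 0.
Let neg f x := Num.max (- f x) 0.

Let pos0 f x : 0 <= pos f x. Proof. by rewrite le_max lexx orbT. Qed.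
Let neg0 f x : 0 <= neg f x. Proof. by rewrite le_max lexx orbT. Qed.
Let posneg f x : f x = pos f x - neg f x.
Proof.
by rewrite /pos /neg; set y := f x; case: (lerP y 0) => y0;
  [rewrite max_l|rewrite max_r]; lra.
Qed.
Let poss f : summing f -> summing (pos f).
Proof.
apply: summing_le => x; rewrite ger0_norm ?pos0// ge_max normr_ge0 andbT.
exact: ler_norm.
Qed.
Let negs f : summing f -> summing (neg f).
Proof.
apply: summing_le => x; rewrite ger0_norm ?neg0// ge_max normr_ge0 andbT.
by rewrite -normrN ler_norm.
Qed.

Lemma rsumD f g : summing f -> summing g ->
  rsum (fun x => f x + g x) = rsum f + rsum g.
Proof.
move=> fs gs; rewrite (rsum_sub (posneg f))//; [|exact: poss|exact: negs].
rewrite (rsum_sub (posneg g))//; [|exact: poss|exact: negs].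
rewrite (@rsum_sub _ (fun x => pos f x + pos g x) (fun x => neg f x + neg g x)).
- under eq_esum do rewrite EFinD.
  under [X in _ - fine X]eq_esum do rewrite EFinD.
  rewrite !esumD; try by move=> x _; rewrite lee_fin.
  rewrite !fineD ?fin_esum//; [lra| | | |]; by [exact: poss|exact: negs].
- by move=> x; rewrite {1}posneg {1}[g x]posneg; lra.
- by move=> x; rewrite addr_ge0.
- by move=> x; rewrite addr_ge0.
- by apply: summingD; exact: poss.
- by apply: summingD; exact: negs.
Qed.

Lemma summingN f : summing f -> summing (fun x => - f x).
Proof. by rewrite /summing => ff; under eq_esum do rewrite normrN. Qed.

Lemma rsumN f : summing f -> rsum (fun x => - f x) = - rsum f.
Proof.
move=> fs; rewrite (rsum_sub (posneg f))//; [|exact: poss|exact: negs].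
rewrite (@rsum_sub _ (neg f) (pos f)).
- by rewrite opprB.
- by move=> x; rewrite {1}posneg opprB.
- by move=> x.
- by move=> x.
- exact: negs.
- exact: poss.
Qed.

Lemma rsumZ (c : R) f : summing f -> rsum (fun x => c * f x) = c * rsum f.
Proof.
move=> fs.
wlog c0 : c / 0 <= c.
  move=> H; case: (lerP 0 c) => c0; first exact: H.
  transitivity (rsum (fun x => - ((- c) * f x))).
    by congr rsum; apply/funext => x; rewrite mulNr opprK.
  rewrite rsumN; last exact: summingZ.
  by rewrite H ?oppr_ge0 ?ltW// mulNr opprK.
rewrite (rsum_sub (posneg f))//; [|exact: poss|exact: negs].
rewrite (@rsum_sub _ (fun x => c * pos f x) (fun x => c * neg f x)).
- rewrite !esumZ// !fineM// ?fin_esum//;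
  [by rewrite mulrBr|exact: negs|exact: poss].
- by move=> x; rewrite {1}posneg mulrBr.
- by move=> x; rewrite mulr_ge0.
- by move=> x; rewrite mulr_ge0.
- by apply: summingZ; exact: poss.
- by apply: summingZ; exact: negs.
Qed.

Definition csumming (f : T -> R[i]) := summing (fun x => normc (f x)).

Let cRe (f : T -> R[i]) : csumming f -> summing (fun x => complex.Re (f x)).
Proof. by apply: summing_le => x;
  rewrite [leRHS]ger0_norm ?normc_ge0 ?le_Re_normc. Qed.
Let cIm (f : T -> R[i]) : csumming f -> summing (fun x => complex.Im (f x)).
Proof. by apply: summing_le => x;
  rewrite [leRHS]ger0_norm ?normc_ge0 ?le_Im_normc. Qed.

Lemma csumD (f g : T -> R[i]) : csumming f -> csumming g ->
  csum (fun x => f x + g x) = csum f + csum g.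
Proof.
move=> fs gs; rewrite /csum; apply/eqP; rewrite eq_complex /=.
rewrite -(rsumD (cRe fs) (cRe gs)) -(rsumD (cIm fs) (cIm gs)).
by apply/andP; split; apply/eqP; congr rsum; apply/funext => x;
  case: (f x); case: (g x).
Qed.

Lemma csumZ c (f : T -> R[i]) : csumming f ->
  csum (fun x => c * f x) = c * csum f.
Proof.
move=> fs; case: c => a b; rewrite /csum; apply/eqP; rewrite eq_complex /=.
have H1 := cRe fs; have H2 := cIm fs.
rewrite -(rsumZ a H1) -(rsumZ b H2) -(rsumZ a H2) -(rsumZ b H1).
rewrite -(rsumN (summingZ b H2)).
rewrite -(rsumD (summingZ a H1) (summingN (summingZ b H2))).
rewrite -(rsumD (summingZ a H2) (summingZ b H1)).
by apply/andP; split; apply/eqP; congr rsum; apply/funext => x; case: (f x).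
Qed.

Lemma csumJ (f : T -> R[i]) : csumming f ->
  csum (fun x => conjc (f x)) = conjc (csum f).
Proof.
move=> fs; rewrite /csum; apply/eqP; rewrite eq_complex /=.
rewrite -(rsumN (cIm fs)).
by apply/andP; split; apply/eqP; congr rsum; apply/funext => x; case: (f x).
Qed.

End Sums.

(** * The Fock space as an inner product space *)

Section Fock.
Variables (R : realType) (d : option nat).
Local Notation H := (fock R d).
Implicit Types (f g h : H) (w : word d) (c : R[i]).

Lemma fockP f g : (forall w, f w = g w) -> f = g.
Proof. by move=> fg; apply: val_inj; apply/funext. Qed.

Lemma coefD f g w : (f + g) w = f w + g w. Proof. by []. Qed.

Lemma coefN f w : (- f) w = - f w. Proof. by []. Qed.

Lemma coefB f g w : (f - g) w = f w - g w. Proof. by []. Qed.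

Lemma coefZ c f w : (c *: f) w = c * f w. Proof. by []. Qed.

Lemma coef0 w : (0 : H) w = 0. Proof. by []. Qed.

Lemma coef_sum (I : Type) (s : seq I) (F : I -> H) w :
  (\sum_(i <- s) F i) w = \sum_(i <- s) F i w.
Proof.
by elim: s => [|i s IH]; rewrite ?big_nil// !big_cons coefD IH.
Qed.

Lemma to_fockE (F : fseries R d) w :
  F \in @square_summable R d -> to_fock F w = F w.
Proof.
by move=> FS; have E : \val (insubd (0 : H) F) = F := insubdK _ FS;
  rewrite -[in RHS]E.
Qed.

Lemma sqnorm_fin f : sqnorm f \is a fin_num.
Proof.
rewrite ge0_fin_numE; first by case: f => F /= /asboolP.
by apply: esum_ge0 => w _; rewrite lee_fin exprn_ge0// normc_ge0.
Qed.

Lemma fine_sqnorm_ge0 f : 0 <= fine (sqnorm f).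
Proof.
by apply/fine_ge0/esum_ge0 => w _; rewrite lee_fin exprn_ge0// normc_ge0.
Qed.

Lemma fnorm_ge0 f : 0 <= fnorm f. Proof. exact: sqrtr_ge0. Qed.

Lemma fnorm_sqr f : ((fnorm f ^+ 2)%:E = sqnorm f)%E.
Proof. by rewrite sqr_sqrtr ?fine_sqnorm_ge0// fineK// sqnorm_fin. Qed.

Lemma fnorm_sqrE f : fnorm f ^+ 2 = fine (sqnorm f).
Proof. by rewrite sqr_sqrtr ?fine_sqnorm_ge0. Qed.

Lemma sqr_normc_ge0 (F : fseries R d) w : 0 <= normc (F w) ^+ 2.
Proof. by rewrite exprn_ge0// normc_ge0. Qed.

Lemma seq_le_fnorm f (s : seq (word d)) : uniq s ->
  \sum_(w <- s) normc (f w) ^+ 2 <= fnorm f ^+ 2.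
Proof.
move=> us; rewrite -lee_fin fnorm_sqr; apply: seq_le_esum => // w.
exact: sqr_normc_ge0.
Qed.

Lemma seq_near_fnorm f (e : R) : 0 < e ->
  exists2 s : seq (word d), uniq s &
    fnorm f ^+ 2 - e < \sum_(w <- s) normc (f w) ^+ 2.
Proof.
move=> e0; rewrite fnorm_sqrE; apply: seq_near_esum => //.
  by move=> w; exact: sqr_normc_ge0.
by case: f => F /= /asboolP.
Qed.

Lemma square_summable_bound (F : fseries R d) (M : R) :
  (forall s, uniq s -> \sum_(w <- s) normc (F w) ^+ 2 <= M) ->
  F \in @square_summable R d.
Proof.
move=> HM; apply/asboolP; apply: (@le_lt_trans _ _ M%:E); last exact: ltry.
by apply: esum_le_seq => // w; exact: sqr_normc_ge0.
Qed.

Lemma fnorm_bound f (M : R) :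
  (forall s, uniq s -> \sum_(w <- s) normc (f w) ^+ 2 <= M) ->
  fnorm f ^+ 2 <= M.
Proof.
move=> HM; rewrite -lee_fin fnorm_sqr; apply: esum_le_seq => // w.
exact: sqr_normc_ge0.
Qed.

Lemma summing_sq f : summing (fun w => normc (f w) ^+ 2).
Proof.
rewrite /summing [X in (X < _)%E](_ : _ = sqnorm f).
  by case: f => F /= /asboolP.
by apply: eq_esum => w _; rewrite ger0_norm ?sqr_normc_ge0.
Qed.

Lemma inner_csumming f g : csumming (fun w => conjc (f w) * g w).
Proof.
have sq h : summing (fun w => normc (h w) ^+ 2).
  exact: summing_sq.
apply: summing_le (summingD (sq f) (sq g)) => w.
rewrite normcM normc_conj !ger0_norm ?mulr_ge0 ?addr_ge0 ?sqr_normc_ge0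
  ?normc_ge0//.
set x := normc _; set y := normc _.
have := sqr_ge0 (x - y); have := sqr_ge0 x; have := sqr_ge0 y.
rewrite sqrrB mulr2n; lra.
Qed.

Lemma innerDr f g h : inner f (g + h) = inner f g + inner f h.
Proof.
rewrite /inner -csumD; try exact: inner_csumming.
by congr csum; apply/funext => w; rewrite coefD mulrDr.
Qed.

Lemma innerZr c f g : inner f (c *: g) = c * inner f g.
Proof.
rewrite /inner -csumZ; try exact: inner_csumming.
by congr csum; apply/funext => w; rewrite coefZ mulrCA.
Qed.

Lemma innerC f g : inner f g = conjc (inner g f).
Proof.
rewrite /inner -csumJ; try exact: inner_csumming.
by congr csum; apply/funext => w; rewrite conjcM conjcK mulrC.
Qed.

Lemma innerDl f g h : inner (f + g) h = inner f h + inner g h.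
Proof. by rewrite innerC innerDr conjcD -!innerC. Qed.

Lemma innerZl c f g : inner (c *: f) g = conjc c * inner f g.
Proof. by rewrite innerC innerZr conjcM -innerC. Qed.

Lemma innerNr f g : inner f (- g) = - inner f g.
Proof. by rewrite -scaleN1r innerZr mulN1r. Qed.

Lemma innerNl f g : inner (- f) g = - inner f g.
Proof. by rewrite -scaleN1r innerZl conjcN conjc1 mulN1r. Qed.

Lemma innerBr f g h : inner f (g - h) = inner f g - inner f h.
Proof. by rewrite innerDr innerNr. Qed.

Lemma innerBl f g h : inner (f - g) h = inner f h - inner g h.
Proof. by rewrite innerDl innerNl. Qed.

Lemma inner0r f : inner f 0 = 0.
Proof. by rewrite -(scale0r (0 : H)) innerZr mul0r. Qed.

Lemma inner0l f : inner 0 f = 0.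
Proof. by rewrite innerC inner0r conjc0. Qed.

Lemma inner_sumr (I : Type) (s : seq I) f (F : I -> H) :
  inner f (\sum_(i <- s) F i) = \sum_(i <- s) inner f (F i).
Proof.
by elim: s => [|i s IH]; rewrite ?big_nil ?inner0r// !big_cons innerDr IH.
Qed.

Lemma inner_suml (I : Type) (s : seq I) f (F : I -> H) :
  inner (\sum_(i <- s) F i) f = \sum_(i <- s) inner (F i) f.
Proof.
by elim: s => [|i s IH]; rewrite ?big_nil ?inner0l// !big_cons innerDl IH.
Qed.

Lemma inner_ff f : inner f f = (fnorm f ^+ 2)%:C.
Proof.
rewrite /inner /csum fnorm_sqrE; congr (_ +i* _).
  transitivity (rsum (fun w => normc (f w) ^+ 2)).
    by congr rsum; apply/funext => w; rewrite -normc_sqr.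
  rewrite rsum_ge0 => [//|w|]; [exact: sqr_normc_ge0|exact: summing_sq].
transitivity (rsum (fun w : word d => (0 : R))).
  by congr rsum; apply/funext => w; rewrite -normc_sqr.
rewrite rsum_ge0// ?esum1//.
by rewrite /summing esum1 ?ltry// => w _; rewrite normr0.
Qed.

Lemma fnorm0 : fnorm (0 : H) = 0.
Proof.
have := inner_ff 0; rewrite inner0l => /esym/complexI/eqP.
by rewrite expf_eq0 => /eqP.
Qed.

Lemma fnorm_eq0 f : fnorm f = 0 -> f = 0.
Proof.
move=> f0; apply: fockP => w; apply: eq0_normc; apply/eqP.
have := @seq_le_fnorm f [:: w] isT; rewrite big_seq1 f0 expr0n /= => H1.
by rewrite -sqrf_eq0 eq_le H1 sqr_normc_ge0.
Qed.

Lemma inner_eq0 f : inner f f = 0 -> f = 0.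
Proof.
rewrite inner_ff => /complexI/eqP; rewrite sqrf_eq0 => /eqP.
exact: fnorm_eq0.
Qed.

Lemma fnormZ c f : fnorm (c *: f) = normc c * fnorm f.
Proof.
apply/eqP; rewrite -(@eqrXn2 _ 2) ?fnorm_ge0 ?mulr_ge0 ?fnorm_ge0 ?normc_ge0//.
apply/eqP; apply: complexI;
  rewrite exprMn (realcM (normc c ^+ 2)) -!inner_ff innerZl innerZr normc_sqr.
by rewrite mulrA.
Qed.

Lemma fnormN f : fnorm (- f) = fnorm f.
Proof. by rewrite -scaleN1r fnormZ normcN normc1 mul1r. Qed.

Lemma fnormBC f g : fnorm (f - g) = fnorm (g - f).
Proof. by rewrite -fnormN opprB. Qed.

Lemma fnorm_sqrD f g : fnorm (f + g) ^+ 2 =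
  fnorm f ^+ 2 + fnorm g ^+ 2 + 2 * complex.Re (inner f g).
Proof.
have := inner_ff (f + g); rewrite innerDl !innerDr !inner_ff (innerC g f).
by case: (inner f g) => a b /= -[<- _]; lra.
Qed.

(** The Pythagorean theorem for the component of g orthogonal to f, multiplied
    by |f|^2 to avoid a division. It gives the Cauchy-Schwarz inequality, and
    the orthogonality of shortest vectors. *)
Lemma fnorm_sqr_proj f g :
  fnorm ((fnorm f ^+ 2)%:C *: g - inner f g *: f) ^+ 2 =
  fnorm f ^+ 2 * (fnorm f ^+ 2 * fnorm g ^+ 2 - normc (inner f g) ^+ 2).
Proof.
set n := fnorm f ^+ 2; set t := inner f g.
apply: complexI; rewrite -inner_ff innerBl !innerBr !innerZl !innerZr.
rewrite conjc_real (innerC g f) -/t !inner_ff -/n.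
by rewrite (realcM n) realcB (realcM n) normc_sqr; ring.
Qed.

Lemma inner_CS f g : normc (inner f g) <= fnorm f * fnorm g.
Proof.
have [f0|f0] := eqVneq (fnorm f) 0.
  by rewrite (fnorm_eq0 f0) inner0l normc0 fnorm0 mul0r.
have fp : 0 < fnorm f by rewrite lt_def f0 fnorm_ge0.
have np : 0 < fnorm f ^+ 2 by rewrite exprn_gt0.
have := exprn_ge0 2 (fnorm_ge0 ((fnorm f ^+ 2)%:C *: g - inner f g *: f)).
rewrite fnorm_sqr_proj pmulr_rge0// subr_ge0 -exprMn ler_pXn2r//.
- by rewrite nnegrE normc_ge0.
- by rewrite nnegrE mulr_ge0 ?fnorm_ge0.
Qed.

Lemma ler_fnormD f g : fnorm (f + g) <= fnorm f + fnorm g.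
Proof.
rewrite -(@ler_pXn2r _ 2)// ?nnegrE ?addr_ge0 ?fnorm_ge0// fnorm_sqrD sqrrD.
have := le_trans (le_Re_normc (inner f g)) (inner_CS f g).
move=> /(le_trans (ler_norm _)); rewrite mulr2n; lra.
Qed.

Lemma ler_fnormB f g : fnorm (f - g) <= fnorm f + fnorm g.
Proof. by rewrite -(fnormN g) ler_fnormD. Qed.

Lemma ler_fdist f g h : fnorm (f - h) <= fnorm (f - g) + fnorm (g - h).
Proof. by rewrite -{1}(subrK g f) -addrA ler_fnormD. Qed.

Lemma fnorm_small_eq0 f : (forall e, 0 < e -> fnorm f <= e) -> f = 0.
Proof.
move=> He; apply: fnorm_eq0; apply/eqP; rewrite eq_le fnorm_ge0 andbT.
by apply/ler_addgt0Pr => e e0; rewrite add0r; exact: He.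
Qed.

Lemma parallelogram f g :
  fnorm (f + g) ^+ 2 + fnorm (f - g) ^+ 2 = 2 * fnorm f ^+ 2 + 2 * fnorm g ^+ 2.
Proof.
apply: complexI; rewrite !realcD !(realcM 2) -!inner_ff.
rewrite !innerDl !innerNl !innerDr !innerNr; ring.
Qed.

Lemma le_coef_fnorm f w : normc (f w) <= fnorm f.
Proof.
have := @seq_le_fnorm f [:: w] isT; rewrite big_seq1.
by rewrite ler_pXn2r// nnegrE ?normc_ge0 ?fnorm_ge0.
Qed.

Lemma monomial_square_summable w : @monomial R d w \in @square_summable R d.
Proof.
apply: (@square_summable_bound _ 1) => s us.
have [ws|ws] := boolP (w \in s).
  rewrite (bigD1_seq w)//= big1 ?addr0; last first.
    by move=> v vw; rewrite /monomial (negbTE vw) normc0 expr0n.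
  by rewrite /monomial eqxx normc1 expr1n.
rewrite big_seq big1 => [|v vs]; first exact: ler01.
by rewrite /monomial; case: eqP vs ws => [-> ->//|_ _ _]; rewrite normc0 expr0n.
Qed.

(** * Basis vectors and finite truncations *)

Definition delta w : H := to_fock (@monomial R d w).

Lemma deltaE w v : delta w v = (v == w)%:R.
Proof. by rewrite to_fockE// monomial_square_summable. Qed.

Lemma summing_dirac (c : R) w : summing (fun v : word d => c * (v == w)%:R).
Proof.
apply: summingZ; rewrite /summing; apply: (@le_lt_trans _ _ 1%:E);
  last exact: ltry.
apply: esum_le_seq => // s us.
have [ws|ws] := boolP (w \in s).
  rewrite (bigD1_seq w)//= big1 ?addr0; last first.
    by move=> v vw; rewrite (negbTE vw) normr0.
  by rewrite eqxx normr1.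
rewrite big_seq big1 => [|v vs]; first exact: ler01.
by case: eqP vs ws => [-> ->//|_ _ _]; rewrite normr0.
Qed.

Lemma rsum_dirac (c : R) w : rsum (fun v : word d => c * (v == w)%:R) = c.
Proof.
rewrite rsumZ; last first.
  by have := summing_dirac 1 w; congr summing; apply/funext => v; rewrite mul1r.
rewrite rsum_ge0//; last first.
  by have := summing_dirac 1 w; congr summing; apply/funext => v; rewrite mul1r.
rewrite (_ : esum _ _ = 1%:E) ?mulr1//.
transitivity (\esum_(v in [set w]) (1%:E : \bar R)); last first.
  by rewrite esum_set1// lee_fin ler01.
rewrite [RHS]esum_mkcond; apply: eq_esum => v _.
case: eqP => [->|vw]; first by rewrite mem_set.
by rewrite memNset//= => /esym.
Qed.

Lemma inner_delta w f : inner (delta w) f = f w.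
Proof.
rewrite /inner /csum [RHS](_ : _ = complex.Re (f w) +i* complex.Im (f w));
  last first.
  by case: (f w).
congr (_ +i* _).
  rewrite -[RHS](rsum_dirac _ w); congr rsum; apply/funext => v.
  rewrite deltaE; case: eqP => [->|_]; last by rewrite rmorph0 mul0r mulr0.
  by rewrite rmorph1 mul1r mulr1.
rewrite -[RHS](rsum_dirac _ w); congr rsum; apply/funext => v.
rewrite deltaE; case: eqP => [->|_]; last by rewrite rmorph0 mul0r mulr0.
by rewrite rmorph1 mul1r mulr1.
Qed.

Lemma fnorm_delta w : fnorm (delta w) = 1.
Proof.
have := inner_ff (delta w);
  rewrite inner_delta deltaE eqxx => /esym/complexI/eqP.
by rewrite sqrp_eq1 ?fnorm_ge0// => /eqP.
Qed.

Lemma inner_ext f g : (forall h, inner h f = inner h g) -> f = g.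
Proof. by move=> fg; apply: fockP => w; rewrite -!inner_delta fg. Qed.

Lemma ler_fnorm_sum (I : Type) (s : seq I) (F : I -> H) :
  fnorm (\sum_(i <- s) F i) <= \sum_(i <- s) fnorm (F i).
Proof.
elim: s => [|i s IH]; first by rewrite !big_nil fnorm0.
by rewrite !big_cons (le_trans (ler_fnormD _ _))// lerD2l.
Qed.

Definition cutoff (s : seq (word d)) (F : fseries R d) : H :=
  \sum_(w <- s) F w *: delta w.

Lemma cutoffE s (F : fseries R d) w :
  uniq s -> cutoff s F w = if w \in s then F w else 0.
Proof.
move=> us; rewrite coef_sum; case: ifPn => ws.
  under eq_bigr do rewrite coefZ deltaE.
  rewrite (bigD1_seq w)//= eqxx mulr1 big1 ?addr0// => v vw.
  by rewrite eq_sym (negbTE vw) mulr0.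
rewrite big_seq big1// => v vs; rewrite coefZ deltaE; case: eqP => [wv|].
  by rewrite wv vs in ws.
by rewrite mulr0.
Qed.

Lemma inner_cutoff s (F : fseries R d) g :
  inner (cutoff s F) g = \sum_(w <- s) conjc (F w) * g w.
Proof.
by rewrite inner_suml; apply: eq_bigr => w _; rewrite innerZl inner_delta.
Qed.

Lemma fnorm_cutoff s (F : fseries R d) : uniq s ->
  fnorm (cutoff s F) ^+ 2 = \sum_(w <- s) normc (F w) ^+ 2.
Proof.
move=> us; apply: complexI; rewrite -inner_ff inner_cutoff rmorph_sum /=.
rewrite big_seq [RHS]big_seq; apply: eq_bigr => w ws.
by rewrite cutoffE// ws -normc_sqr.
Qed.

Lemma cutoffB s (F G : fseries R d) : cutoff s (F - G) = cutoff s F - cutoff s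
  G.
Proof.
rewrite /cutoff -sumrB; apply: eq_bigr => w _.
by rewrite -scalerBl.
Qed.

Lemma cutoff_near f (e : R) : 0 < e ->
  exists2 s, uniq s & fnorm (f - cutoff s f) < e.
Proof.
move=> e0; have [s us Hs] := seq_near_fnorm f (exprn_gt0 2 e0).
exists s => //; rewrite -(@ltr_pXn2r _ 2)// ?nnegrE ?fnorm_ge0 ?ltW//.
rewrite fnorm_sqrD fnormN innerNr innerC inner_cutoff fnorm_cutoff//.
have -> : \sum_(w <- s) conjc (f w) * f w = (\sum_(w <- s) normc (f w) ^+ 2)%:C.
  by rewrite rmorph_sum; apply: eq_bigr => w _; rewrite -normc_sqr.
by rewrite conjc_real /=; lra.
Qed.

(** * Completeness *)

Lemma cauchy_real (u : nat -> R) :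
  (forall e : R, 0 < e -> exists N, forall m n, (N <= m)%N -> (N <= n)%N ->
     `|u m - u n| <= e) ->
  exists l : R, forall e : R, 0 < e ->
    exists N, forall n, (N <= n)%N -> `|u n - l| <= e.
Proof.
move=> Hu.
have : cvgn u.
  apply/cauchy_cvgP/cauchy_exP => e e0.
  have [N HN] := Hu (e / 2) (divr_gt0 e0 (ltr0n _ 2)).
  exists (u N); exists N => // n /= Nn; rewrite /ball /=.
  by apply: le_lt_trans (HN _ _ (leqnn N) Nn) _; lra.
move=> /cvgrPdist_le Hl; exists (lim (u @ \oo)) => e e0.
have [N _ HN] := Hl _ e0; exists N => n Nn; rewrite distrC.
exact: HN.
Qed.

Lemma cauchy_complex (u : nat -> R[i]) :
  (forall e : R, 0 < e -> exists N, forall m n, (N <= m)%N -> (N <= n)%N ->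
     normc (u m - u n) <= e) ->
  exists l, forall e : R, 0 < e ->
    exists N, forall n, (N <= n)%N -> normc (u n - l) <= e.
Proof.
move=> Hu.
have [|a Ha] := @cauchy_real (fun n => complex.Re (u n)).
  move=> e /Hu[N HN]; exists N => m n Nm Nn; apply: le_trans (HN m n Nm Nn).
  by rewrite -ReB le_Re_normc.
have [|b Hb] := @cauchy_real (fun n => complex.Im (u n)).
  move=> e /Hu[N HN]; exists N => m n Nm Nn; apply: le_trans (HN m n Nm Nn).
  apply: le_trans (le_Im_normc _).
  by case: (u m) => ? ?; case: (u n).
exists (a +i* b) => e e0; have e20 : 0 < e / 2 by rewrite divr_gt0.
have [N1 H1] := Ha _ e20; have [N2 H2] := Hb _ e20.
exists (maxn N1 N2) => n; rewrite geq_max => /andP[n1 n2].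
apply: le_trans (le_normc_ReIm _) _; have := H1 n n1; have := H2 n n2.
by case: (u n) => x y /=; lra.
Qed.

(** The limit is taken coefficient by coefficient; the Cauchy estimate passes
    to the limit on each finite set of words, hence for the norm. *)
Lemma fock_complete (u : nat -> H) :
  (forall e : R, 0 < e -> exists N, forall m n, (N <= m)%N -> (N <= n)%N ->
     fnorm (u m - u n) <= e) ->
  exists l, forall e : R, 0 < e ->
    exists N, forall n, (N <= n)%N -> fnorm (u n - l) <= e.
Proof.
move=> Hu.
have Hw w : exists l, forall e, 0 < e ->
    exists N, forall n, (N <= n)%N -> normc (u n w - l) <= e.
  apply: cauchy_complex => e /Hu[N HN]; exists N => m n Nm Nn.
  exact: le_trans (le_coef_fnorm (u m - u n) w) (HN m n Nm Nn).
have [L HL] := choice Hw.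
have Hs (s : seq (word d)) (e : R) : 0 < e -> exists N, forall n, (N <= n)%N ->
    \sum_(w <- s) normc (u n w - L w) <= e.
  elim: s e => [|w s IH] e e0; first by exists 0%N => n _; rewrite big_nil ltW.
  have e20 : 0 < e / 2 by rewrite divr_gt0.
  have [N1 H1] := IH _ e20; have [N2 H2] := HL w _ e20.
  exists (maxn N1 N2) => n; rewrite geq_max big_cons => /andP[n1 n2].
  by have := H1 n n1; have := H2 n n2; lra.
have key (e : R) N : 0 < e -> (forall m n, (N <= m)%N -> (N <= n)%N ->
     fnorm (u m - u n) <= e) -> forall n s, (N <= n)%N -> uniq s ->
     \sum_(w <- s) normc ((coef (u n) - L) w) ^+ 2 <= e ^+ 2.
  move=> e0 HN n s Nn us; rewrite -fnorm_cutoff//.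
  rewrite ler_pXn2r//; [|by rewrite nnegrE fnorm_ge0|by rewrite nnegrE ltW].
  apply/ler_addgt0Pr => e' e'0.
  have [N' HN'] := Hs s e' e'0.
  set m := maxn N N'.
  have -> : cutoff s (coef (u n) - L) =
            cutoff s (u n - u m) + cutoff s (coef (u m) - L).
    by rewrite !cutoffB addrA subrK.
  apply: le_trans (ler_fnormD _ _) _; apply: lerD.
    apply: le_trans (HN n m Nn (leq_maxl _ _)).
    rewrite -(@ler_pXn2r _ 2)// ?nnegrE ?fnorm_ge0// fnorm_cutoff//.
    exact: seq_le_fnorm.
  apply: le_trans (HN' m (leq_maxr _ _)); apply: le_trans (ler_fnorm_sum _ _) _.
  by apply: ler_sum => w _; rewrite fnormZ fnorm_delta mulr1.
have [N0 HN0] := Hu _ (@ltr01 R).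
have dS : coef (u N0) - L \in @square_summable R d.
  by apply: (@square_summable_bound _ (1 ^+ 2)) => s us; exact: (key _ N0).
have LS : L \in @square_summable R d.
  rewrite -[L](subKr (coef (u N0))); apply: rpredB => //; exact: valP.
exists (to_fock L) => e e0; have [N HN] := Hu _ e0; exists N => n Nn.
rewrite -(@ler_pXn2r _ 2)//;
  [|by rewrite nnegrE fnorm_ge0|by rewrite nnegrE ltW].
have LE : coef (to_fock L) = L by apply/funext => w; exact: to_fockE.
apply: fnorm_bound => s us; have := key e N e0 HN n s Nn us.
by rewrite -[X in coef (u n) - X]LE.
Qed.

End Fock.

(** * Bounded operators and adjoints *)

Section Operators.
Variables (R : realType) (d : option nat).
Local Notation H := (fock R d).
Implicit Types (f g h x y : H) (w : word d) (c : R[i]) (S T : H -> H).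

Definition contractive T := forall h, fnorm (T h) <= fnorm h.

Definition self_adjoint T := forall f g, inner (T f) g = inner f (T g).

Section BoundedOp.
Variables (T : H -> H) (bT : bounded_op T).

Lemma bopP c f g : T (c *: f + g) = c *: T f + T g.
Proof. by case: bT => lT _; exact: lT. Qed.

Lemma bopD f g : T (f + g) = T f + T g.
Proof. by have := bopP 1 f g; rewrite !scale1r. Qed.

Lemma bop0 : T 0 = 0.
Proof. by have /eqP := bopD 0 0; rewrite addr0 -subr_eq subrr => /eqP/esym. Qed.

Lemma bopZ c f : T (c *: f) = c *: T f.
Proof. by have := bopP c f 0; rewrite !addr0 bop0 addr0. Qed.

Lemma bopN f : T (- f) = - T f.
Proof. by rewrite -scaleN1r bopZ scaleN1r. Qed.

Lemma bopB f g : T (f - g) = T f - T g.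
Proof. by rewrite bopD bopN. Qed.

Lemma bop_coef_sub f g w : T g w = 0 -> T (f - g) w = T f w.
Proof. by move=> g0; rewrite bopB coefB g0 subr0. Qed.

Lemma bop_sum (I : Type) (s : seq I) (F : I -> H) :
  T (\sum_(i <- s) F i) = \sum_(i <- s) T (F i).
Proof.
by elim: s => [|i s IH]; rewrite ?big_nil ?bop0// !big_cons bopD IH.
Qed.

Lemma bop_bound : exists2 M : R, 0 < M & forall h, fnorm (T h) <= M * fnorm h.
Proof.
case: bT => _ [M HM]; exists (Num.max M 1); first by rewrite lt_max ltr01 orbT.
move=> h; apply: le_trans (HM h) _.
by rewrite ler_wpM2r ?fnorm_ge0// le_max lexx.
Qed.

(** The value of the adjoint at f has coefficients the pairings of f with the
    images of the basis vectors, and these are square-summable because finitely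
    many of them define a vector p with |p|^2 = <T p, f>. *)
Lemma adj_exists : exists S, forall f g, inner (S f) g = inner f (T g).
Proof.
have [M M0 HM] := bop_bound.
pose F f : fseries R d := fun w => inner (T (delta R w)) f.
have FS f : F f \in @square_summable R d.
  apply: (@square_summable_bound _ _ _ ((M * fnorm f) ^+ 2)) => s us.
  rewrite -fnorm_cutoff//; set p := cutoff s (F f).
  apply: le_sqr; first exact: fnorm_ge0.
  have [->|p0] := eqVneq p 0; first by rewrite fnorm0 mulr_ge0 ?fnorm_ge0// ltW.
  have pp : 0 < fnorm p.
    by rewrite lt_def fnorm_ge0 andbT; apply: contra_neq p0; exact: fnorm_eq0.
  have pE : inner (T p) f = (fnorm p ^+ 2)%:C.
    have -> : T p = \sum_(w <- s) F f w *: T (delta R w).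
      by rewrite bop_sum; apply: eq_bigr => w _; rewrite bopZ.
    rewrite -inner_ff (inner_cutoff s (F f) p) inner_suml.
    rewrite big_seq [RHS]big_seq; apply: eq_bigr => w ws.
    by rewrite innerZl /p cutoffE// ws.
  have := inner_CS (T p) f; rewrite pE normc_real ger0_norm ?exprn_ge0
    ?fnorm_ge0//.
  rewrite expr2 => H1; rewrite -(ler_pM2l pp); apply: le_trans H1 _.
  by rewrite mulrA [_ * M]mulrC ler_wpM2r ?fnorm_ge0.
exists (fun f => to_fock (F f)) => f g.
apply/eqP; rewrite -subr_eq0; apply/eqP; apply: small_eq0 => e e0.
set K := fnorm (to_fock (F f)) + fnorm f * M.
have K0 : 0 <= K by rewrite addr_ge0 ?mulr_ge0 ?fnorm_ge0 ?ltW.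
have [s us Hs] := @cutoff_near R d g (e / (K + 1)) (divr_gt0 e0 (ltr_wpDl K0
  ltr01)).
set p := cutoff s g in Hs.
have E : inner (to_fock (F f)) p = inner f (T p).
  rewrite bop_sum inner_sumr innerC inner_cutoff rmorph_sum /=.
  apply: eq_bigr => w _; rewrite conjcM conjcK bopZ innerZr to_fockE//.
  by rewrite /F -innerC.
have -> : inner (to_fock (F f)) g - inner f (T g) =
    inner (to_fock (F f)) (g - p) - inner f (T (g - p)).
  by rewrite bopB !innerBr E; ring.
apply: le_trans (le_normcD _ _) _; rewrite normcN.
have H1 := inner_CS (to_fock (F f)) (g - p).
have H2 := inner_CS f (T (g - p)).
have H3 : fnorm f * fnorm (T (g - p)) <= fnorm f * M * fnorm (g - p).
  by rewrite -mulrA ler_wpM2l ?fnorm_ge0.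
have H4 : K * fnorm (g - p) <= e.
  apply: (@le_trans _ _ ((K + 1) * fnorm (g - p))).
    by rewrite ler_wpM2r ?fnorm_ge0// lerDl.
  by rewrite mulrC -ler_pdivlMr ?ltr_wpDl// ltW.
apply: le_trans H4; rewrite /K mulrDl.
apply: lerD; first exact: H1.
exact: le_trans H2 H3.
Qed.

Lemma adjP f g : inner (adj T f) g = inner f (T g).
Proof.
have [S HS] := adj_exists.
exact: (@xgetPex _ (fun=> 0) [set S | forall f g, inner (S f) g = inner f (T g)]
  (ex_intro _ S HS)).
Qed.

Lemma adjPr f g : inner f (adj T g) = inner (T f) g.
Proof. by rewrite innerC adjP -innerC. Qed.

Lemma adj_bound (M : R) : (forall h, fnorm (T h) <= M * fnorm h) ->
  forall f, fnorm (adj T f) <= M * fnorm f.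
Proof.
move=> HM f; have [a0|a0] := eqVneq (fnorm (adj T f)) 0.
  by rewrite a0 (le_trans _ (HM f))// fnorm_ge0.
have ap : 0 < fnorm (adj T f) by rewrite lt_def a0 fnorm_ge0.
have := inner_CS f (T (adj T f)); rewrite -adjP inner_ff normc_real.
rewrite ger0_norm ?exprn_ge0 ?fnorm_ge0// expr2 => H1.
rewrite -(ler_pM2l ap); apply: le_trans H1 _.
by rewrite mulrC mulrCA mulrA ler_wpM2r ?fnorm_ge0// mulrC HM.
Qed.

Lemma adj_bop : bounded_op (adj T).
Proof.
split; last by have [M _ HM] := bop_bound; exists M; exact: adj_bound.
move=> c f g; apply: inner_ext => h.
by rewrite adjPr innerDr !innerZr !innerDr !innerZr !adjPr.
Qed.

Lemma adj_contractive : contractive T -> contractive (adj T).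
Proof.
by move=> HT f; rewrite -[leRHS]mul1r; apply: adj_bound => h; rewrite mul1r.
Qed.

End BoundedOp.

Lemma bop_id : bounded_op (@id H).
Proof. by split=> //; exists 1 => h; rewrite mul1r. Qed.

Lemma bop_comp S T : bounded_op S -> bounded_op T -> bounded_op (S \o T).
Proof.
move=> bS bT; split=> [c f g|]; first by rewrite /= (bopP bT) (bopP bS).
have [M M0 HM] := bop_bound bS; have [N N0 HN] := bop_bound bT.
exists (M * N) => h; apply: le_trans (HM _) _.
by rewrite -mulrA ler_wpM2l// ltW.
Qed.

Lemma bop_sub S T : bounded_op S -> bounded_op T ->
  bounded_op (fun h => S h - T h).
Proof.
move=> bS bT; split=> [c f g|].
  rewrite (bopP bT) (bopP bS) opprD scalerBr addrACA.
  by [].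
have [M M0 HM] := bop_bound bS; have [N N0 HN] := bop_bound bT.
exists (M + N) => h; apply: le_trans (ler_fnormB _ _) _.
by rewrite mulrDl lerD.
Qed.

Lemma contractive_bop T : linear T -> contractive T -> bounded_op T.
Proof. by move=> lT cT; split=> //; exists 1 => h; rewrite mul1r. Qed.

Lemma bop_ext_dense S T (P : H -> Prop) : bounded_op S -> bounded_op T ->
  (forall h, P h -> S h = T h) ->
  forall x, (forall e : R, 0 < e -> exists2 h,
    P h & fnorm (x - h) <= e) -> S x = T x.
Proof.
move=> bS bT ST x Hx; apply/eqP; rewrite -subr_eq0; apply/eqP.
have bD := bop_sub bS bT.
have [M M0 HM] := bop_bound bD.
apply: fnorm_small_eq0 => e e0; have [h Ph Hh] := Hx _ (divr_gt0 e0 M0).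
have := HM (x - h); rewrite (bopB bD) /= (ST h Ph) subrr subr0.
by move=> /le_trans; apply; rewrite mulrC -ler_pdivlMr.
Qed.

(** * Orthogonal projection and factorization through a range *)

Lemma inv_nat_small (e : R) : 0 < e ->
  exists N, forall n, (N <= n)%N -> n.+1%:R^-1 <= e.
Proof.
move=> e0; have [N _ HN] := near_infty_natSinv_lt (PosNum e0).
by exists N => n Nn; apply/ltW/HN.
Qed.

(** Completeness for approximate solutions: P e x reads as x solves a problem
    up to e. If good approximate solutions are close to each other, they
    converge. *)
Lemma complete_pred (P : R -> H -> Prop) :
  (forall (e e' : R) x, e <= e' -> P e x -> P e' x) ->
  (forall e : R, 0 < e -> exists x, P e x) ->
  (forall e : R, 0 < e -> exists2 dl : R, 0 < dl &
     forall x y, P dl x -> P dl y -> fnorm (x - y) <= e) ->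
  exists l, forall e : R, 0 < e -> exists2 dl : R, 0 < dl &
     forall x, P dl x -> fnorm (x - l) <= e.
Proof.
move=> Pmon Pne Psmall.
have invn_gt0 n : 0 < n.+1%:R^-1 :> R by rewrite invr_gt0.
have [u Hu] := choice (fun n : nat => Pne n.+1%:R^-1 (invn_gt0 n)).
have Pu (dl : R) : 0 < dl -> exists N, forall n, (N <= n)%N -> P dl (u n).
  move=> /inv_nat_small[N HN]; exists N => n Nn.
  exact: Pmon (HN n Nn) (Hu n).
have [|l Hl] := @fock_complete R d u.
  move=> e /Psmall[dl /Pu[N HN] Hdl]; exists N => m n Nm Nn.
  by apply: Hdl; exact: HN.
exists l => e e0; have e20 : 0 < e / 2 by rewrite divr_gt0.
have [dl dl0 Hdl] := Psmall _ e20; exists dl => // x Px.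
have [N1 HN1] := Pu _ dl0; have [N2 HN2] := Hl _ e20.
apply: le_trans (ler_fdist x (u (maxn N1 N2)) l) _; rewrite [leRHS]splitr.
by apply: lerD; [exact: Hdl _ _ Px (HN1 _ (leq_maxl N1 N2))|exact/HN2/leq_maxr].
Qed.

(** The distance from x to a subspace P is approached by x - s with s in P; by
    the parallelogram law such differences converge, and the limit is
    orthogonal to P because it cannot be shortened by a multiple of an element
    of P. *)
Lemma projection (P : H -> Prop) x : P 0 ->
  (forall c f g, P f -> P g -> P (c *: f + g)) ->
  exists y, (forall s, P s -> inner s y = 0) /\
    (forall e : R, 0 < e -> exists2 s, P s & fnorm (x - s - y) <= e).
Proof.
move=> P0 Plin.
pose D := [set fnorm (x - s) ^+ 2 | s in [set s | P s]].
have Dinf : has_inf D.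
  split; first by exists (fnorm (x - 0) ^+ 2), 0.
  by exists 0 => _ [s _ <-]; rewrite exprn_ge0 ?fnorm_ge0.
set m := inf D.
have mle s : P s -> m <= fnorm (x - s) ^+ 2.
  by move=> Ps; apply: ge_inf; [exact: Dinf.2|exists s].
have m0 : 0 <= m.
  by apply: lb_le_inf; [exact: Dinf.1|move=> _ [s _ <-];
    rewrite exprn_ge0 ?fnorm_ge0].
pose Q (e : R) z := exists2 s, P s & z = x - s /\ fnorm z ^+ 2 <= m + e.
have Qmid e z1 z2 : Q e z1 -> Q e z2 -> fnorm (z1 - z2) ^+ 2 <= 4 * e.
  move=> [s1 Ps1 [-> H1]] [s2 Ps2 [-> H2]].
  have := parallelogram (x - s1) (x - s2).
  have Ps : P ((1 / 2)%:C *: (s1 + s2)).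
    by rewrite -[X in P X]addr0; apply: (Plin) => //; rewrite -[s1]scale1r;
      exact: Plin.
  have := mle _ Ps.
  have -> : x - s1 + (x - s2) = 2%:C *: (x - (1 / 2)%:C *: (s1 + s2)).
    apply: fockP => w; rewrite !(coefD, coefN, coefZ).
    rewrite mulrBr mulrA -realcM mulrA mulr1 divff ?pnatr_eq0// mul1r.
    by rewrite (_ : 2%:C = 1 + 1 :> R[i]) ?realcD//; ring.
  rewrite fnormZ normc_real ger0_norm// exprMn.
  set a := fnorm (x - s1) ^+ 2 in H1 *; set b := fnorm (x - s2) ^+ 2 in H2 *.
  set p := fnorm _ ^+ 2; set q := fnorm _ ^+ 2.
  by move=> H3 H4; move: H1 H2 H3 H4; lra.
have [|e e0|e e0|y Hy] := @complete_pred Q.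
- by move=> e e' z ee' [s Ps [-> Hs]]; exists s => //; split=> //; lra.
- have [_ [s Ps <-] Hs] := inf_adherent e0 Dinf.
  by exists (x - s), s => //; split=> //; exact: ltW.
- exists (e ^+ 2 / 4); first by rewrite divr_gt0 ?exprn_gt0.
  move=> z1 z2 Q1 Q2; apply: le_of_sqr; first exact: ltW.
  by have := Qmid _ _ _ Q1 Q2; lra.
have approx (e : R) : 0 < e ->
    exists2 s, P s & fnorm (x - s - y) <= e /\ fnorm (x - s) ^+ 2 <= m + e ^+ 2.
  move=> e0; have [dl dl0 Hdl] := Hy _ e0.
  have e20 : 0 < e ^+ 2 by rewrite exprn_gt0.
  have mp : 0 < Num.min dl (e ^+ 2) by rewrite lt_min dl0.
  have [_ [s Ps <-] /ltW Hs] := inf_adherent mp Dinf.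
  have m1 : Num.min dl (e ^+ 2) <= e ^+ 2 by rewrite ge_min lexx orbT.
  have m2 : Num.min dl (e ^+ 2) <= dl by rewrite ge_min lexx.
  exists s => //; split; last by apply: le_trans Hs _; rewrite lerD2l.
  by apply: Hdl; exists s => //; split=> //; apply: le_trans Hs _;
    rewrite lerD2l.
exists y; split; last by move=> e /approx[s Ps [Hs _]]; exists s.
pose mu := Num.sqrt m.
have mu2 : mu ^+ 2 = m by rewrite sqr_sqrtr.
have mu0 : 0 <= mu by exact: sqrtr_ge0.
have y_le : fnorm y <= mu.
  apply/ler_addgt0Pr => e e0; have e20 : 0 < e / 2 by rewrite divr_gt0.
  have [s Ps [H1 H2]] := approx _ e20.
  have H3 : fnorm (x - s) <= mu + e / 2.
    apply: le_of_sqr; first by rewrite addr_ge0// ltW.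
    apply: le_trans H2 _; rewrite sqrrD mu2.
    have : 0 <= mu * (e / 2) by rewrite mulr_ge0// ltW.
    by rewrite mulr2n; lra.
  have := ler_fnormB (x - s) (x - s - y).
  by rewrite subKr; lra.
have le_y s : P s -> mu <= fnorm (y - s).
  move=> Ps; apply/ler_addgt0Pr => e e0; have [s' Ps' [H1 _]] := approx _ e0.
  have Pss : P (s + s') by rewrite -[s]scale1r; exact: Plin.
  have H2 : mu <= fnorm (x - (s + s')).
    by apply: le_of_sqr; rewrite ?fnorm_ge0// mu2 mle.
  apply: le_trans H2 _.
  have -> : x - (s + s') = (y - s) + (x - s' - y).
    by apply: fockP => w; rewrite !(coefD, coefN); ring.
  by apply: le_trans (ler_fnormD _ _) _; rewrite lerD2l.
move=> s Ps; have [s0|s0] := eqVneq (fnorm s) 0.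
  by rewrite (fnorm_eq0 s0) inner0l.
have sp : 0 < fnorm s by rewrite lt_def s0 fnorm_ge0.
have np : 0 < fnorm s ^+ 2 by rewrite exprn_gt0.
have := fnorm_sqr_proj s y; set n := fnorm s ^+ 2; set t := inner s y.
have -> : n%:C *: y - t *: s = n%:C *: (y - (n^-1%:C * t) *: s).
  rewrite scalerBr scalerA mulrA -realcM divff ?mul1r// lt0r_neq0//.
rewrite fnormZ normc_real ger0_norm ?ltW// exprMn expr2 -mulrA.
have /mulfI nI := lt0r_neq0 np; move=> /nI.
have Pt : P ((n^-1%:C * t) *: s) by rewrite -[X in P X]addr0; exact: Plin.
have H1 : fnorm y ^+ 2 <= fnorm (y - (n^-1%:C * t) *: s) ^+ 2.
  by apply: le_sqr; rewrite ?fnorm_ge0// (le_trans y_le)// le_y.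
move=> E; have : 0 <= - normc t ^+ 2.
  have : n * fnorm y ^+ 2 <= n * fnorm (y - (n^-1%:C * t) *: s) ^+ 2.
    by rewrite ler_pM2l.
  by rewrite E; lra.
rewrite oppr_ge0 => H2; apply: eq0_normc; apply/eqP.
by rewrite -sqrf_eq0 eq_le H2 exprn_ge0 ?normc_ge0.
Qed.

Definition orth_range T y := forall h, inner (T h) y = 0.

Lemma fnorm_orth_le f g : inner f g = 0 -> fnorm f <= fnorm (f + g).
Proof.
move=> fg; apply: le_of_sqr; rewrite ?fnorm_ge0// fnorm_sqrD fg /=.
by rewrite mulr0 addr0 lerDl exprn_ge0 ?fnorm_ge0.
Qed.

Lemma range_approx T x : bounded_op T ->
  exists2 y, orth_range T y &
    forall e : R, 0 < e -> exists h, fnorm (x - y - T h) <= e.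
Proof.
move=> bT.
have [||y [y1 y2]] := @projection (fun s => exists h, s = T h) x.
- by exists 0; rewrite bop0.
- by move=> c _ _ [f ->] [g ->]; exists (c *: f + g); rewrite bopP.
exists y; first by move=> h; apply: y1; exists h.
by move=> e /y2[_ [h ->] Hh]; exists h; rewrite addrAC.
Qed.

(** The map sending T h to S h is well defined and contractive on the range of
    T, so it extends to the closure; it is set to 0 on the orthocomplement. *)
Lemma Douglas S T : bounded_op S -> bounded_op T ->
  (forall h, fnorm (S h) <= fnorm (T h)) ->
  exists V, [/\ bounded_op V, contractive V, forall h, V (T h) = S h &
    forall y, orth_range T y -> V y = 0].
Proof.
move=> bS bT ST.
have HV x : exists l, forall e : R, 0 < e -> exists2 dl : R, 0 < dl &
    forall h y, orth_range T y -> fnorm (x - y - T h) <= dl -> fnorm (S h - l)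
      <= e.
  have [y0 y0T y0x] := range_approx x bT.
  pose Q (e : R) z :=
    exists h y, [/\ z = S h, orth_range T y & fnorm (x - y - T h) <= e].
  have [|e e0|e e0|l Hl] := @complete_pred Q.
  - by move=> e e' z ee' [h [y [-> yT Hh]]]; exists h, y; split=> //; lra.
  - by have [h Hh] := y0x _ e0; exists (S h), h, y0; split.
  - exists (e / 2); first by rewrite divr_gt0.
    move=> _ _ [h [y [-> yT Hh]]] [h' [y' [-> yT' Hh']]].
    rewrite -bopB//; apply: le_trans (ST _) _.
    apply: (@le_trans _ _ (fnorm (T (h - h') + (y - y')))).
      by apply: fnorm_orth_le; rewrite innerBr yT yT' subrr.
    have -> : T (h - h') + (y - y') = (x - y' - T h') - (x - y - T h).
      by rewrite (bopB bT); apply: fockP => w; rewrite !(coefD, coefN); ring.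
    by apply: le_trans (ler_fnormB _ _) _; lra.
  exists l => e e0; have [dl dl0 Hdl] := Hl _ e0; exists dl => // h y yT Hh.
  by apply: Hdl; exists h, y.
have [V VP] := choice HV.
have Vapprox x (e : R) : 0 < e -> exists2 dl : R, 0 < dl & dl <= e /\
    forall h y, orth_range T y -> fnorm (x - y - T h) <= dl -> fnorm (S h - V
      x) <= e.
  move=> e0; have [dl dl0 Hdl] := VP x _ e0.
  exists (Num.min dl e); first by rewrite lt_min dl0.
  split=> [|h y yT Hh]; first by rewrite ge_min lexx orbT.
  by apply: (Hdl h y) => //; apply: le_trans Hh _; rewrite ge_min lexx.
have VT h : V (T h) = S h.
  apply/eqP; rewrite -subr_eq0; apply/eqP; apply: fnorm_small_eq0 => e e0.
  have [dl dl0 Hdl] := VP (T h) _ e0; rewrite fnormBC.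
  apply: (Hdl h 0); first by move=> ?; rewrite inner0r.
  by rewrite subr0 subrr fnorm0 ltW.
have V0 y : orth_range T y -> V y = 0.
  move=> yT; apply: fnorm_small_eq0 => e e0; have [dl dl0 Hdl] := VP y _ e0.
  have := Hdl 0 y yT; rewrite (bop0 bT) (bop0 bS) subr0 subrr fnorm0 sub0r
    fnormN.
  by apply; exact: ltW.
have cV : contractive V.
  move=> x; apply/ler_addgt0Pr => e e0;
    have e20 : 0 < e / 2 by rewrite divr_gt0.
  have [dl dl0 [dle Hdl]] := Vapprox x _ e20.
  have [y yT yx] := range_approx x bT; have [h Hh] := yx _ dl0.
  have H1 := Hdl h y yT Hh; have H2 := ST h.
  have H3 : fnorm (T h) <= fnorm (T h + y) by apply: fnorm_orth_le.
  have H4 : fnorm (T h + y) <= fnorm x + dl.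
    have -> : T h + y = x - (x - y - T h).
      by apply: fockP => w; rewrite !(coefD, coefN); ring.
    by apply: le_trans (ler_fnormB _ _) _; rewrite lerD2l.
  have := ler_fnormB (S h) (S h - V x); rewrite subKr; lra.
exists V; split=> //; apply: contractive_bop => // c f g.
apply/eqP; rewrite -subr_eq0; apply/eqP; apply: fnorm_small_eq0 => e e0.
pose k := normc c + 1; have k0 : 0 < k by rewrite ltr_wpDl ?normc_ge0.
pose e' := e / (k + 1); have e'0 : 0 < e' by rewrite divr_gt0// addr_gt0.
have [dl dl0 [_ Hdl]] := Vapprox (c *: f + g) _ (divr_gt0 e0 (ltr0n _ 2)).
have e2k : 0 < e / 2 / k by rewrite divr_gt0// divr_gt0.
have [dlf dlf0 [_ Hf]] := Vapprox f _ e2k.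
have [dlg dlg0 [_ Hg]] := Vapprox g _ e2k.
pose m := Num.min (Num.min dlf dlg) (dl / k).
have m0 : 0 < m by rewrite !lt_min dlf0 dlg0 divr_gt0.
have [y yT yf] := range_approx f bT; have [h Hh] := yf _ m0.
have [z zT zg] := range_approx g bT; have [j Hj] := zg _ m0.
have {Hf} Hf := Hf h y yT (le_trans Hh _).
have {Hg} Hg := Hg j z zT (le_trans Hj _).
have H1 : fnorm (S (c *: h + j) - V (c *: f + g)) <= e / 2.
  apply: (Hdl _ (c *: y + z)).
    by move=> u; rewrite innerDr innerZr yT zT mulr0 addr0.
  have -> : c *: f + g - (c *: y + z) - T (c *: h + j) =
            c *: (f - y - T h) + (g - z - T j).
    by rewrite (bopP bT); apply: fockP => w; rewrite !(coefD, coefN, coefZ);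
      ring.
  apply: le_trans (ler_fnormD _ _) _; rewrite fnormZ.
  have : k * m <= dl by rewrite mulrC -ler_pdivlMr// /m ge_min lexx orbT.
  have := ler_wpM2l (normc_ge0 c) Hh; rewrite /k mulrDl; lra.
have -> : V (c *: f + g) - (c *: V f + V g) =
  c *: (S h - V f) + (S j - V g) - (S (c *: h + j) - V (c *: f + g)).
  by rewrite (bopP bS); apply: fockP => w; rewrite !(coefD, coefN, coefZ); ring.
apply: le_trans (ler_fnormB _ _) _.
have := ler_fnormD (c *: (S h - V f)) (S j - V g); rewrite fnormZ.
have Hf' := Hf _; have Hg' := Hg _.
have mf : m <= dlf by rewrite !ge_min lexx.
have mg : m <= dlg by rewrite !ge_min lexx orbT.
have := ler_wpM2l (normc_ge0 c) (Hf mf); have := Hg mg.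
have : k * (e / 2 / k) = e / 2 by rewrite mulrC divfK// lt0r_neq0.
by rewrite /k mulrDl mul1r; lra.
Qed.

End Operators.

(** * Positive square roots *)

Section SquareRoot.
Variables (R : realType) (d : option nat).
Local Notation H := (fock R d).
Implicit Types (f g h x y : H) (w : word d) (c : R[i]) (S T X : H -> H).

Definition tends_to (u : nat -> H) l :=
  forall e : R, 0 < e -> exists N, forall n, (N <= n)%N -> fnorm (u n - l) <= e.

Lemma tends_to_unique (u : nat -> H) l l' :
  tends_to u l -> tends_to u l' -> l = l'.
Proof.
move=> ul ul'; apply/eqP; rewrite -subr_eq0; apply/eqP.
apply: fnorm_small_eq0 => e e0; have e20 : 0 < e / 2 by rewrite divr_gt0.
have [N1 H1] := ul _ e20; have [N2 H2] := ul' _ e20.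
apply: le_trans (ler_fdist _ (u (maxn N1 N2)) _) _; rewrite [leRHS]splitr.
by apply: lerD; [rewrite fnormBC; exact/H1/leq_maxl|exact/H2/leq_maxr].
Qed.

Lemma tends_to_lin c (u v : nat -> H) l l' : tends_to u l -> tends_to v l' ->
  tends_to (fun n => c *: u n + v n) (c *: l + l').
Proof.
move=> ul vl e e0; pose k := normc c + 1.
have k0 : 0 < k by rewrite ltr_wpDl ?normc_ge0.
have e1 : 0 < e / 2 / k by rewrite !divr_gt0.
have e2 : 0 < e / 2 by rewrite divr_gt0.
have [N1 H1] := ul _ e1; have [N2 H2] := vl _ e2.
exists (maxn N1 N2) => n; rewrite geq_max => /andP[/H1 {}H1 /H2 {}H2].
rewrite opprD addrACA -scalerBr [leRHS]splitr.
apply: le_trans (ler_fnormD _ _) _; apply: lerD => //; rewrite fnormZ.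
apply: (@le_trans _ _ (k * fnorm (u n - l))).
  by rewrite ler_wpM2r ?fnorm_ge0// lerDl.
by rewrite mulrC -ler_pdivlMr.
Qed.

Lemma tends_to_bop T (u : nat -> H) l : bounded_op T -> tends_to u l ->
  tends_to (fun n => T (u n)) (T l).
Proof.
move=> bT ul e e0; have [M M0 HM] := bop_bound bT.
have [N HN] := ul _ (divr_gt0 e0 M0); exists N => n Nn.
rewrite -(bopB bT); apply: le_trans (HM _) _.
by rewrite mulrC -ler_pdivlMr// HN.
Qed.

Lemma le_tends_to (u : nat -> H) l (M : R) : tends_to u l ->
  (forall n, fnorm (u n) <= M) -> fnorm l <= M.
Proof.
move=> ul uM; apply/ler_addgt0Pr => e /ul[N /(_ N (leqnn N)) HN].
have := ler_fnormB (u N) (u N - l); rewrite subKr => /le_trans; apply.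
exact: lerD.
Qed.

Lemma eq_inner_tends_to (u v : nat -> H) l l' f g :
  tends_to u l -> tends_to v l' ->
  (forall n, inner (u n) g = inner f (v n)) -> inner l g = inner f l'.
Proof.
move=> ul vl uv; apply/eqP; rewrite -subr_eq0; apply/eqP.
apply: small_eq0 => e e0.
have K0 h : 0 < fnorm h + 1 by rewrite ltr_wpDl ?fnorm_ge0.
have [N1 H1] := ul _ (divr_gt0 (divr_gt0 e0 (ltr0n _ 2)) (K0 g)).
have [N2 H2] := vl _ (divr_gt0 (divr_gt0 e0 (ltr0n _ 2)) (K0 f)).
set n := maxn N1 N2.
have -> : inner l g - inner f l' = inner f (v n - l') - inner (u n - l) g.
  by rewrite innerBl innerBr uv; ring.
apply: le_trans (le_normcD _ _) _; rewrite normcN [leRHS]splitr.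
have bnd h x (a : R) : 0 < a -> fnorm x <= a / (fnorm h + 1) ->
    fnorm h * fnorm x <= a.
  move=> a0 xa; rewrite -(@divfK _ (fnorm h + 1) _ a) ?lt0r_neq0// mulrC.
  by apply: ler_pM; rewrite ?fnorm_ge0// lerDl.
apply: lerD.
  apply: le_trans (inner_CS _ _) _; apply: bnd; first by rewrite divr_gt0.
  exact/H2/leq_maxr.
apply: le_trans (inner_CS _ _) _; rewrite mulrC; apply: bnd;
  first by rewrite divr_gt0.
exact/H1/leq_maxl.
Qed.

(** The case X = 1 of the operator recursion below; it majorizes the operator
    recursion for every contraction X, and converges because it increases
    and stays below 1. *)
Fixpoint sqrt_rate (n : nat) : R :=
  if n is n'.+1 then (1 + sqrt_rate n' ^+ 2) / 2 else 0.

Fixpoint sqrt_iter X (n : nat) (h : H) : H :=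
  if n is n'.+1 then (1 / 2)%:C *: (X h + sqrt_iter X n' (sqrt_iter X n' h))
  else 0.

Lemma sqrt_rate_bound n : 0 <= sqrt_rate n <= 1.
Proof.
elim: n => [|n /andP[IH0 IH1]] /=; first by rewrite lexx ler01.
have : sqrt_rate n ^+ 2 <= 1 by rewrite expr_le1.
have : 0 <= sqrt_rate n ^+ 2 by rewrite exprn_ge0.
lra.
Qed.

Lemma sqrt_rate_nondecr n : sqrt_rate n <= sqrt_rate n.+1.
Proof.
have := sqr_ge0 (1 - sqrt_rate n); rewrite /= sqrrB expr1n mul1r mulr2n.
set a := sqrt_rate n ^+ 2; lra.
Qed.

Lemma sqrt_rate_mono m n : (m <= n)%N -> sqrt_rate m <= sqrt_rate n.
Proof.
move=> /subnK <-; elim: (n - m)%N => [|k IH]; first by rewrite add0n.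
by rewrite addSn (le_trans IH)// sqrt_rate_nondecr.
Qed.

Lemma sqrt_rate_cauchy (e : R) : 0 < e -> exists N, forall m n,
  (N <= m)%N -> (m <= n)%N -> sqrt_rate n - sqrt_rate m <= e.
Proof.
move=> e0; pose D := [set sqrt_rate n | n in [set: nat]].
have Dsup : has_sup D.
  split; first by exists (sqrt_rate 0), 0%N.
  by exists 1 => _ [n _ <-]; have /andP[] := sqrt_rate_bound n.
have [_ [N _ <-] HN] := sup_adherent e0 Dsup; exists N => m n Nm mn.
have H1 : sqrt_rate n <= sup D by apply: sup_upper_bound => //; exists n.
have H2 := sqrt_rate_mono Nm.
lra.
Qed.

Section Iteration.
Variables (X : H -> H) (bX : bounded_op X) (cX : contractive X).

Lemma sqrt_iter_bop n : bounded_op (sqrt_iter X n).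
Proof.
elim: n => [|n IH] /=.
  split=> [c f g|]; first by rewrite scaler0 addr0.
  by exists 0 => h; rewrite fnorm0 mul0r.
have [_ [M HM]] := bop_comp IH IH; have [N N0 HN] := bop_bound bX.
split=> [c f g|].
  rewrite (bopP bX) (bopP IH) (bopP IH) !scalerDr !scalerA [c * _]mulrC.
  by rewrite addrACA.
exists ((N + M) / 2) => h; rewrite fnormZ normc_real ger0_norm ?divr_ge0//.
have := le_trans (ler_fnormD _ _) (lerD (HN h) (HM h)); rewrite -mulrDl /=.
by rewrite mulrAC; lra.
Qed.

Lemma sqrt_iter_bound n h : fnorm (sqrt_iter X n h) <= sqrt_rate n * fnorm h.
Proof.
elim: n h => [|n IH] h /=; first by rewrite fnorm0 mul0r.
rewrite fnormZ normc_real ger0_norm ?divr_ge0//.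
have /andP[r0 _] := sqrt_rate_bound n.
have H1 := le_trans (IH (sqrt_iter X n h)) (ler_wpM2l r0 (IH h)).
have := le_trans (ler_fnormD _ _) (lerD (cX h) H1).
rewrite mulrA -expr2 mulrAC mulrDl mul1r; lra.
Qed.

(** The difference of the squares of two consecutive iterates Y, Y' is Y (Y -
    Y') + (Y - Y') Y', which is bounded without any commutation. *)
Lemma sqrt_iter_step n h :
  fnorm (sqrt_iter X n.+1 h - sqrt_iter X n h) <=
  (sqrt_rate n.+1 - sqrt_rate n) * fnorm h.
Proof.
elim: n h => [|n IH] h; first by rewrite subr0 [_ - sqrt_rate 0]subr0
  sqrt_iter_bound.
have bY := sqrt_iter_bop n.+1; have bY' := sqrt_iter_bop n.
set Y := sqrt_iter X n.+1 in IH bY *; set Y' := sqrt_iter X n in IH bY' *.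
have -> : sqrt_iter X n.+2 h - Y h =
    (1 / 2)%:C *: (Y (Y h - Y' h) + (Y (Y' h) - Y' (Y' h))).
  rewrite (bopB bY) addrA subrK /= -/Y -/Y' {2}/Y /= -/Y' -scalerBr.
  by congr (_ *: _); rewrite opprD addrACA subrr add0r.
rewrite fnormZ normc_real ger0_norm ?divr_ge0//.
have /andP[r0 _] := sqrt_rate_bound n; have /andP[s0 _] := sqrt_rate_bound n.+1.
have H1 := le_trans (sqrt_iter_bound n.+1 (Y h - Y' h)) (ler_wpM2l s0 (IH h)).
have rr0 : 0 <= sqrt_rate n.+1 - sqrt_rate n by rewrite subr_ge0
  sqrt_rate_nondecr.
have H2 := le_trans (IH (Y' h)) (ler_wpM2l rr0 (sqrt_iter_bound n h)).
have := le_trans (ler_fnormD _ _) (lerD H1 H2).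
have -> : sqrt_rate n.+2 - sqrt_rate n.+1 =
   (sqrt_rate n.+1 ^+ 2 - sqrt_rate n ^+ 2) / 2.
  transitivity ((1 + sqrt_rate n.+1 ^+ 2) / 2 - (1 + sqrt_rate n ^+ 2) / 2) =>
    //.
  set s2 := sqrt_rate n.+1 ^+ 2; set r2 := sqrt_rate n ^+ 2; lra.
set s := sqrt_rate n.+1; set r := sqrt_rate n; set t := fnorm h.
have -> : s * ((s - r) * t) + (s - r) * (r * t) = (s ^+ 2 - r ^+ 2) * t by ring.
by rewrite mulrAC; lra.
Qed.

Lemma sqrt_iter_dist m n h : (m <= n)%N ->
  fnorm (sqrt_iter X n h - sqrt_iter X m h) <=
  (sqrt_rate n - sqrt_rate m) * fnorm h.
Proof.
move=> /subnK <-; elim: (n - m)%N => [|k IH].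
  by rewrite add0n !subrr fnorm0 mul0r.
apply: le_trans (ler_fdist _ (sqrt_iter X (k + m) h) _) _.
have := lerD (sqrt_iter_step (k + m) h) IH; rewrite -mulrDl addrA subrK.
by rewrite addSn.
Qed.

(** The fixed point Y = (X + Y^2) / 2, that is 1 - sqrt (1 - X). *)
Definition sqrt_defect h : H := xget 0 [set l | tends_to (sqrt_iter X ^~ h) l].

Lemma sqrt_defectP h : tends_to (sqrt_iter X ^~ h) (sqrt_defect h).
Proof.
have [|l Hl] := @fock_complete R d (sqrt_iter X ^~ h); last first.
  exact: (@xgetPex _ 0 [set l | tends_to (sqrt_iter X ^~ h) l] (ex_intro _ l
    Hl)).
move=> e e0; have k0 : 0 < fnorm h + 1 by rewrite ltr_wpDl ?fnorm_ge0.
have [N HN] := sqrt_rate_cauchy (divr_gt0 e0 k0); exists N => m n.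
wlog mn : m n / (m <= n)%N.
  move=> W Nm Nn; case: (leqP m n) => [mn|/ltnW nm]; first exact: W.
  by rewrite fnormBC; exact: W.
move=> Nm Nn; rewrite fnormBC; apply: le_trans (sqrt_iter_dist h mn) _.
apply: (@le_trans _ _ ((sqrt_rate n - sqrt_rate m) * (fnorm h + 1))).
  by rewrite ler_wpM2l ?lerDl// subr_ge0 sqrt_rate_mono.
by rewrite -ler_pdivlMr// HN.
Qed.

Lemma sqrt_defect_linear : linear sqrt_defect.
Proof.
move=> c f g; apply: tends_to_unique (sqrt_defectP _) _.
have -> : sqrt_iter X ^~ (c *: f + g) =
    (fun n => c *: sqrt_iter X n f + sqrt_iter X n g).
  by apply/funext => n; rewrite (bopP (sqrt_iter_bop n)).
exact: tends_to_lin (sqrt_defectP f) (sqrt_defectP g).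
Qed.

Lemma sqrt_defect_contractive : contractive sqrt_defect.
Proof.
move=> h; apply: le_tends_to (sqrt_defectP h) _ => n.
apply: le_trans (sqrt_iter_bound n h) _; rewrite ler_piMl ?fnorm_ge0//.
by have /andP[] := sqrt_rate_bound n.
Qed.

Lemma sqrt_defect_bop : bounded_op sqrt_defect.
Proof. exact: contractive_bop sqrt_defect_linear sqrt_defect_contractive. Qed.

Lemma sqrt_defect_eq h :
  sqrt_defect h = (1 / 2)%:C *: (X h + sqrt_defect (sqrt_defect h)).
Proof.
apply: tends_to_unique (sqrt_defectP _) _ => e e0.
have e20 : 0 < e / 2 by rewrite divr_gt0.
have [N1 H1] := sqrt_defectP h e20.
have [N2 H2] := sqrt_defectP (sqrt_defect h) e20.
exists (maxn N1 N2).+1 => -[//|n]; rewrite ltnS geq_max => /andP[n1 n2] /=.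
set Y := sqrt_iter X n; rewrite -scalerBr fnormZ normc_real ger0_norm
  ?divr_ge0//.
have bY : bounded_op Y by exact: sqrt_iter_bop.
have -> : X h + Y (Y h) - (X h + sqrt_defect (sqrt_defect h)) =
   Y (Y h - sqrt_defect h) + (Y (sqrt_defect h) - sqrt_defect (sqrt_defect h)).
  by rewrite (bopB bY) addrA subrK opprD addrACA subrr add0r.
have H3 : fnorm (Y (Y h - sqrt_defect h)) <= fnorm (Y h - sqrt_defect h).
  apply: le_trans (sqrt_iter_bound n _) _; rewrite ler_piMl ?fnorm_ge0//.
  by have /andP[] := sqrt_rate_bound n.
apply: (@le_trans _ _ (1 / 2 * (e / 2 + e / 2))); last by lra.
rewrite ler_wpM2l ?divr_ge0//; apply: le_trans (ler_fnormD _ _) _.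
by apply: lerD; [apply: le_trans H3 _; exact: H1|exact: H2].
Qed.

Lemma sqrt_iter_sa n : self_adjoint X -> self_adjoint (sqrt_iter X n).
Proof.
move=> sX; elim: n => [|n IH] f g /=; first by rewrite inner0l inner0r.
by rewrite innerZl innerZr innerDl innerDr sX !IH conjc_real.
Qed.

Lemma sqrt_defect_sa : self_adjoint X -> self_adjoint sqrt_defect.
Proof.
move=> sX f g; apply: eq_inner_tends_to (sqrt_defectP f) (sqrt_defectP g) _ =>
  n.
exact: sqrt_iter_sa.
Qed.

Definition psqrt h := h - sqrt_defect h.

Lemma psqrt_bop : bounded_op psqrt.
Proof. exact: bop_sub (bop_id R d) sqrt_defect_bop. Qed.

Lemma psqrtK h : psqrt (psqrt h) = h - X h.
Proof.
rewrite /psqrt (bopB sqrt_defect_bop).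
have := sqrt_defect_eq h; set Y := sqrt_defect h; set YY := sqrt_defect Y => YE.
have {YE} -> : X h = Y + Y - YY.
  rewrite {1 2}YE -scalerDl -realcD (_ : 1 / 2 + 1 / 2 = 1); last by lra.
  by rewrite scale1r addrK.
by rewrite !opprD !opprK !addrA.
Qed.

Lemma psqrt_positive : self_adjoint X -> positive_op psqrt.
Proof.
move=> sX; split=> [|h]; first exact: psqrt_bop.
have sD := sqrt_defect_sa sX h h; rewrite /psqrt innerBr inner_ff ge0cE.
rewrite ImB ReB (_ : complex.Im (inner h (sqrt_defect h)) = 0); last first.
  by apply/conjc_realP; rewrite -innerC.
rewrite subr0 eqxx subr_ge0; apply: le_trans (ler_norm _) _.
apply: le_trans (le_Re_normc _) _; apply: le_trans (inner_CS _ _) _.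
by rewrite expr2 ler_wpM2l ?fnorm_ge0//; exact: sqrt_defect_contractive.
Qed.

End Iteration.

(** Every iterate is a polynomial in the contraction, so an operator that
    intertwines the contractions intertwines the iterates and their limits. *)
Lemma psqrt_intertwine X X' Z : bounded_op X -> contractive X ->
  bounded_op X' -> contractive X' -> bounded_op Z ->
  (forall h, Z (X h) = X' (Z h)) -> forall h, Z (psqrt X h) = psqrt X' (Z h).
Proof.
move=> bX cX bX' cX' bZ ZX h; rewrite (bopB bZ); congr (_ - _).
have it n g : Z (sqrt_iter X n g) = sqrt_iter X' n (Z g).
  elim: n g => [|n IH] g /=; first exact: bop0.
  by rewrite (bopZ bZ) (bopD bZ) ZX !IH.
apply: tends_to_unique (sqrt_defectP bX' cX' (Z h)).
have := tends_to_bop bZ (sqrt_defectP bX cX h).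
by under eq_fun do rewrite it.
Qed.

(** Polarization: the form is real on the diagonal at f + g and at f + i g. *)
Lemma positive_sa T : positive_op T -> self_adjoint T.
Proof.
move=> [bT pT] f g.
have H1 h : inner (T h) h = inner h (T h).
  rewrite innerC; apply/conjc_realP.
  by have := pT h; rewrite ge0cE => /andP[/eqP].
have E1 := H1 (f + g); have E2 := H1 (f + 'i *: g).
move: E1 E2; rewrite !(bopD bT) (bopZ bT) !(innerDl, innerDr, innerZl, innerZr).
rewrite !H1.
set p := inner (T f) g; set q := inner (T g) f.
set p' := inner f (T g); set q' := inner g (T f).
set a := inner f (T f); set b := inner g (T g).
have ii : conjc 'i = - 'i :> R[i] by rewrite /=; apply/eqP;
  rewrite eq_complex /= oppr0 !eqxx.
rewrite ii => E1 E2.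
have S1 : p + q = q' + p'.
  apply/eqP; rewrite -subr_eq0; move/eqP: E1; rewrite -subr_eq0 => /eqP E1.
  by apply/eqP; rewrite -E1; ring.
have S2 : 'i * (p - q) = 'i * (p' - q').
  apply/eqP; rewrite -subr_eq0; move/eqP: E2; rewrite -subr_eq0 => /eqP E2.
  by apply/eqP; rewrite -E2; ring.
have i0 : 'i != 0 :> R[i] by rewrite eq_complex /= oner_eq0 andbF.
move/(mulfI i0): S2 => S2.
have : 2%:R * p = 2%:R * p'.
  have -> : 2%:R * p = (p + q) + (p - q) by ring.
  by rewrite S1 S2; ring.
by apply: mulfI; rewrite pnatr_eq0.
Qed.

(** Positivity on x - t T x, for a small t > 0, forces |T x|^2 to vanish. *)
Lemma positive_eq0 T x : positive_op T -> inner x (T x) = 0 -> T x = 0.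
Proof.
move=> pT xTx; have [bT pTh] := pT; have sT := positive_sa pT.
have [M M0 HM] := bop_bound bT.
(* t = 1 / M for a bound M of T is small enough. *)
pose n := fnorm (T x) ^+ 2; pose q := complex.Re (inner (T x) (T (T x))).
have q_le : q <= M * n.
  apply: le_trans (ler_norm _) _; apply: le_trans (le_Re_normc _) _.
  apply: le_trans (inner_CS _ _) _;
    rewrite /n expr2 mulrCA ler_wpM2l ?fnorm_ge0//.
have := pTh (x + (- M^-1)%:C *: T x).
rewrite !(bopD bT) (bopZ bT) !(innerDl, innerDr, innerZl,
  innerZr) conjc_real xTx.
rewrite -(sT x (T x)) inner_ff -/n add0r lecE => /andP[_].
rewrite !ReD !ReZ -/q.
have -> : complex.Re n%:C = n by [].
have -> : complex.Re 0 = 0 :> R by [].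
set r := M^-1 => Hr; have r0 : 0 < r by rewrite invr_gt0.
have {}Hr : 0 <= r * (r * q - 2 * n) by move: Hr; rewrite -?mulNrn; lra.
rewrite pmulr_rge0// subr_ge0 in Hr.
have {}q_le : r * q <= n by rewrite ler_pdivrMl.
have n0 : 0 <= n by rewrite exprn_ge0 ?fnorm_ge0.
have nE : n = 0 by lra.
by apply: fnorm_eq0; apply/eqP; rewrite -sqrf_eq0 -/n nE.
Qed.

(** With y = (S - T) x one has <y, S y> + <y, T y> = <y, (S^2 - T^2) x> = 0, so
    both S and T kill y, and then |y|^2 = <(S - T) y, x> = 0. *)
Lemma positive_sqrt_unique S T : positive_op S -> positive_op T ->
  (forall h, S (S h) = T (T h)) -> (forall h, S (T h) = T (S h)) ->
  S = T.
Proof.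
move=> pS pT SSTT STTS; have [bS posS] := pS; have [bT posT] := pT.
apply/funext => x; pose y := S x - T x.
have : inner y (S y) + inner y (T y) = 0.
  rewrite -innerDr (bopB bS) (bopB bT) SSTT STTS [X in inner _ X](_ : _ = 0)
    ?inner0r//.
  by apply: fockP => w; rewrite !(coefD, coefN); ring.
move=> /eqP; rewrite paddr_eq0; [|exact: posS|exact: posT].
move=> /andP[/eqP /(positive_eq0 pS) Sy /eqP /(positive_eq0 pT) Ty].
apply/eqP; rewrite -subr_eq0; apply/eqP; apply: inner_eq0.
by rewrite -/y innerBr -(positive_sa pS) -(positive_sa pT) Sy Ty subrr.
Qed.

End SquareRoot.

(** * Reversal of words, multiplication operators and shifts *)

Section Multiplication.
Variables (R : realType) (d : option nat).
Local Notation H := (fock R d).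
Implicit Types (f g h : H) (w : word d) (k : letter d) (c : R[i]).
Implicit Types (F : fseries R d).

(** A word is empty or has a first letter. *)
Lemma esum_words (F : word d -> \bar R) : (forall w, 0 <= F w)%E ->
  (\esum_(w in [set: word d]) F w =
   F [::] +
   \esum_(k in [set: letter d]) \esum_(w in [set: word d]) F (k :: w))%E.
Proof.
move=> F0; rewrite (esumID [set [::]])// setTI esum_set1//; congr (_ + _)%E.
rewrite (@esum_esum R _ _ [set: letter d] (fun=> [set: word d])
  (fun k w => F (k :: w)))//.
rewrite -(@esum_image R _ _ _ (fun kw : letter d * word d => kw.1 :: kw.2) F).
  congr esum; apply/seteqP; split=> [[|k w] /= [_]//|w [[k v] _ <-]//].
  by exists (k, w).
by move=> [k w] [k' w'] _ _ /= [-> ->].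
Qed.

(** Polynomials are dense. *)
Lemma bop_ext_delta (S T : H -> H) : bounded_op S -> bounded_op T ->
  (forall w, S (delta R w) = T (delta R w)) -> S = T.
Proof.
move=> bS bT ST; apply/funext => h.
apply: (@bop_ext_dense _ _ S T (fun h => S h = T h)) => // e e0.
have [s us Hs] := @cutoff_near R d h e e0; exists (cutoff s h); last exact: ltW.
rewrite (bop_sum bS) (bop_sum bT); apply: eq_bigr => w _.
by rewrite (bopZ bS) (bopZ bT) ST.
Qed.

Lemma transpose_square_summable F : F \in @square_summable R d ->
  transpose F \in @square_summable R d.
Proof.
move=> FS; pose f := to_fock F.
apply: (@square_summable_bound _ _ _ (fnorm f ^+ 2)) => s us.
have usr : uniq (map rev s) by rewrite map_inj_uniq//; exact: (can_inj revK).
have := seq_le_fnorm f usr; rewrite big_map; apply: le_trans.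
by apply: ler_sum => w _; rewrite to_fockE.
Qed.

Lemma coef_square_summable f : coef f \in @square_summable R d.
Proof. exact: valP f. Qed.
Hint Resolve coef_square_summable : core.

Lemma UtE h w : Ut h w = h (rev w).
Proof. by rewrite to_fockE// transpose_square_summable. Qed.

Lemma UtK : involutive (@Ut R d).
Proof. by move=> h; apply: fockP => w; rewrite !UtE revK. Qed.

Lemma fnorm_Ut h : fnorm (Ut h) = fnorm h.
Proof.
suff le_Ut g : fnorm (Ut g) <= fnorm g.
  by apply/eqP; rewrite eq_le le_Ut -{1}[h]UtK le_Ut.
apply: le_of_sqr; rewrite ?fnorm_ge0//; apply: fnorm_bound => s us.
have usr : uniq (map rev s) by rewrite map_inj_uniq//; exact: (can_inj revK).
have := seq_le_fnorm g usr; rewrite big_map; apply: le_trans.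
by apply: ler_sum => w _; rewrite UtE.
Qed.

Lemma Ut_bop : bounded_op (@Ut R d).
Proof.
split; last by exists 1 => h; rewrite fnorm_Ut mul1r.
by move=> c f g; apply: fockP => w; rewrite !(UtE, coefD, coefZ).
Qed.

Lemma smul_linear F c (f g : fseries R d) w :
  smul F (c *: f + g) w = c * smul F f w + smul F g w.
Proof.
rewrite /smul mulr_sumr -big_split /=; apply: eq_bigr => i _.
have -> : (c *: f + g) (drop i w) = c * f (drop i w) + g (drop i w) by [].
by rewrite mulrDr mulrCA.
Qed.

Lemma lmulE F h w : multiplier F -> lmul F h w = smul F h w.
Proof. by move=> [FS _]; rewrite to_fockE. Qed.

(** Bounds on finite sets of coefficients suffice to recognize a multiplier. *)
Lemma multiplierI F (M : R) :
  (forall h s, uniq s ->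
     \sum_(w <- s) normc (smul F h w) ^+ 2 <= M * fnorm h ^+ 2) ->
  multiplier F /\ forall h, fnorm (lmul F h) ^+ 2 <= M * fnorm h ^+ 2.
Proof.
move=> HM; have FS h : smul F h \in @square_summable R d.
  exact: square_summable_bound (HM h).
have Fbound h : fnorm (lmul F h) ^+ 2 <= M * fnorm h ^+ 2.
  apply: fnorm_bound => s us; have := HM h s us; apply: le_trans.
  by apply: ler_sum => w _; rewrite to_fockE.
split=> //; split=> //; split.
  by move=> c f g; apply: fockP => w;
    rewrite !(to_fockE, coefD, coefZ)// -smul_linear.
exists (Num.sqrt `|M|) => h.
apply: le_of_sqr; first by rewrite mulr_ge0 ?sqrtr_ge0 ?fnorm_ge0.
apply: le_trans (Fbound h) _; rewrite exprMn (@sqr_sqrtr _ `|M|)//.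
by rewrite ler_wpM2r ?exprn_ge0 ?fnorm_ge0// ler_norm.
Qed.

Lemma rmul_bop F : multiplier F -> bounded_op (rmul F).
Proof. by move=> [_ bF]; apply: bop_comp Ut_bop; apply: bop_comp Ut_bop bF. Qed.

(** Conjugating left multiplication by F with the reversal of words gives right
    multiplication by the transpose of F. *)
Lemma rmulE F h w : multiplier F ->
  rmul F h w = \sum_(j < (size w).+1) h (take j w) * transpose F (drop j w).
Proof.
move=> mF; rewrite /rmul /= UtE lmulE// /smul size_rev.
rewrite (reindex_inj rev_ord_inj) /=; apply: eq_bigr => -[j jw] _ /=.
rewrite ltnS in jw; rewrite subSS UtE mulrC take_rev drop_rev revK subKn//.
Qed.

Lemma fnorm_rmul F h : fnorm (rmul F h) = fnorm (lmul F (Ut h)).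
Proof. exact: fnorm_Ut. Qed.

Lemma fnorm_lmul F h : fnorm (lmul F h) = fnorm (rmul F (Ut h)).
Proof. by rewrite fnorm_rmul UtK. Qed.

Lemma rmul_delta0 F w : multiplier F -> rmul F (delta R [::]) w = transpose F w.
Proof.
move=> mF; rewrite rmulE// big_ord_recl take0 drop0 deltaE eqxx mul1r.
rewrite big1 ?addr0// => -[j jw] _ /=; rewrite deltaE.
by case: w jw => [//|x v] jw; rewrite mul0r.
Qed.

Lemma smul_letter k F w : smul (@monomial R d [:: k]) F w =
  if w is j :: v then (j == k)%:R * F v else 0.
Proof.
rewrite /smul big_ord_recl take0 /monomial mul0r add0r.
case: w => [|j v]; first by rewrite big_ord0.
rewrite big_ord_recl /= take0 drop0 eqseq_cons eqxx andbT.
rewrite big1 ?addr0// => -[i iv] _ /=; rewrite eqseq_cons.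
by case: v iv => [//|x v] _; rewrite andbF mul0r.
Qed.

Lemma letter_multiplier k : multiplier (@monomial R d [:: k]).
Proof.
apply: (@multiplierI _ 1 _).1 => h s us; rewrite mul1r.
pose s' := [seq w <- s | if w is j :: _ then j == k else false].
have us' : uniq (map behead s').
  rewrite map_inj_in_uniq ?filter_uniq// => -[|i v] [|j v'].
  - by [].
  - by rewrite mem_filter.
  - by move=> _; rewrite mem_filter.
  - by rewrite !mem_filter => /andP[/eqP -> _] /andP[/eqP -> _] /= ->.
apply: le_trans (seq_le_fnorm h us'); rewrite big_map big_filter.
rewrite [leRHS]big_mkcond; apply: ler_sum => -[|j v] _; rewrite smul_letter.
  by rewrite normc0 expr0n.
by case: eqP => _; rewrite ?mul1r// mul0r normc0 expr0n.
Qed.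
Hint Resolve letter_multiplier : core.

Lemma shift_nil k h : shift k h [::] = 0.
Proof. by rewrite /shift lmulE// smul_letter. Qed.

Lemma shift_cons k h j w : shift k h (j :: w) = (j == k)%:R * h w.
Proof. by rewrite /shift lmulE// smul_letter. Qed.

Lemma shift_bop k : bounded_op (@shift R d k).
Proof. by case: (letter_multiplier k). Qed.
Hint Resolve shift_bop : core.

Lemma shift_delta k w : shift k (delta R w) = delta R (k :: w).
Proof.
apply: fockP => -[|j v]; first by rewrite shift_nil deltaE.
by rewrite shift_cons !deltaE eqseq_cons -natrM mulnb.
Qed.

Lemma adj_shiftE k h w : adj (@shift R d k) h w = h (k :: w).
Proof. by rewrite -inner_delta adjPr// shift_delta inner_delta. Qed.

Lemma adj_shift_bop k : bounded_op (adj (@shift R d k)).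
Proof. exact: adj_bop. Qed.
Hint Resolve adj_shift_bop : core.

Lemma adj_shift_shift j k h :
  adj (@shift R d j) (shift k h) = (j == k)%:R *: h.
Proof. by apply: fockP => w; rewrite adj_shiftE shift_cons coefZ. Qed.

Lemma adj_shift_delta0 k : adj (@shift R d k) (delta R [::]) = 0.
Proof. by apply: fockP => w; rewrite adj_shiftE deltaE. Qed.

Lemma fnorm_shift k h : fnorm (shift k h) = fnorm h.
Proof.
have : (fnorm (shift k h) ^+ 2)%:C = (fnorm h ^+ 2)%:C.
  by rewrite -!inner_ff -adjP// adj_shift_shift eqxx scale1r.
move=> /complexI E; apply/eqP; rewrite eq_le.
by apply/andP; split; apply: le_of_sqr; rewrite ?fnorm_ge0// E.
Qed.

Lemma rmul_shift F k h : multiplier F -> rmul F (shift k h) = shift k (rmul F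
  h).
Proof.
move=> mF; apply: fockP => -[|j w].
  by rewrite shift_nil rmulE// big_ord1 take0 shift_nil mul0r.
apply: etrans (rmulE (shift k h) (j :: w) mF) _.
apply: etrans (esym (shift_cons k (rmul F h) j w)).
have -> := rmulE h w mF.
rewrite big_ord_recl take0 shift_nil mul0r add0r mulr_sumr.
by apply: eq_bigr => i _; rewrite /= shift_cons mulrA.
Qed.

Lemma fnorm_words h : ((fnorm h ^+ 2)%:E =
  (normc (h [::]) ^+ 2)%:E +
  \esum_(k in [set: letter d]) (fnorm (adj (@shift R d k) h) ^+ 2)%:E)%E.
Proof.
rewrite fnorm_sqr /sqnorm esum_words => [|w];
  last by rewrite lee_fin sqr_normc_ge0.
congr (_ + _)%E; apply: eq_esum => k _; rewrite fnorm_sqr;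
  apply: eq_esum => w _.
by rewrite adj_shiftE.
Qed.

End Multiplication.
#[global] Hint Resolve coef_square_summable letter_multiplier shift_bop
  adj_shift_bop : core.

(** * The Wold decomposition attached to 1 - B^* B *)

Section Wold.
Variables (R : realType) (d : option nat).
Local Notation H := (fock R d).
Local Notation L := (@shift R d).
Implicit Types (f g h x y z : H) (w : word d) (k j : letter d) (c : R[i]).

Variable B : H -> H.
Hypotheses (bB : bounded_op B) (cB : contractive B).
Hypothesis BL : forall k h, B (L k h) = L k (B h).

(** The positive square root of 1 - B^* B. *)
Variable Dl : H -> H.
Hypothesis Dl_pos : positive_op Dl.
Hypothesis DlK : forall h, Dl (Dl h) = h - adj B (B h).

Let bD : bounded_op Dl. Proof. by case: Dl_pos. Qed.

Lemma defect_sa : self_adjoint Dl.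
Proof. exact: positive_sa Dl_pos. Qed.

Lemma inner_defect f g : inner (Dl f) (Dl g) = inner f g - inner (B f) (B g).
Proof. by rewrite defect_sa DlK innerBr adjPr. Qed.

Lemma fnorm_defect h : fnorm (Dl h) ^+ 2 = fnorm h ^+ 2 - fnorm (B h) ^+ 2.
Proof. by apply: complexI; rewrite realcB -!inner_ff inner_defect. Qed.

Lemma defect_contractive : contractive Dl.
Proof.
move=> h; apply: le_of_sqr; rewrite ?fnorm_ge0// fnorm_defect.
by rewrite gerBl exprn_ge0 ?fnorm_ge0.
Qed.

Lemma fnorm_defect_shift k h : fnorm (Dl (L k h)) = fnorm (Dl h).
Proof.
have E : fnorm (Dl (L k h)) ^+ 2 = fnorm (Dl h) ^+ 2.
  by rewrite (fnorm_defect (L k h)) (fnorm_defect h) BL (fnorm_shift k h)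
    (fnorm_shift k (B h)).
by apply/eqP; rewrite eq_le; apply/andP; split; apply: le_of_sqr;
  rewrite ?fnorm_ge0// E.
Qed.

(** The operator Dl^2 = 1 - B^* B is left Toeplitz because B commutes with the
    isometries L_k. *)
Lemma defect_toeplitz j k h :
  adj (L j) (Dl (Dl (L k h))) = (j == k)%:R *: Dl (Dl h).
Proof.
have E a b : inner (L j a) (L k b) = (j == k)%:R * inner a b.
  by rewrite -(adjPr (shift_bop R j)) adj_shift_shift innerZr.
apply: inner_ext => f; rewrite adjPr// -defect_sa inner_defect !BL !E.
by rewrite -mulrBr -inner_defect defect_sa innerZr.
Qed.

(** The closure of the range of the self-adjoint operator Dl, described as the
    orthocomplement of its kernel. *)
Definition rdefect x := forall y, Dl y = 0 -> inner y x = 0.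

Lemma orth_range_defect y : orth_range Dl y <-> Dl y = 0.
Proof.
split=> [yD|yD h]; last by rewrite defect_sa yD inner0r.
by apply: inner_eq0; rewrite -defect_sa yD.
Qed.

Lemma rdefect_range h : rdefect (Dl h).
Proof. by move=> y yD; rewrite -defect_sa yD inner0l. Qed.

Lemma rdefect_lin c f g : rdefect f -> rdefect g -> rdefect (c *: f + g).
Proof. by move=> fK gK y yD; rewrite innerDr innerZr fK// gK// mulr0 addr0. Qed.

Lemma rdefect_inj x : rdefect x -> Dl x = 0 -> x = 0.
Proof. by move=> xK xD; apply: inner_eq0; exact: xK. Qed.

Lemma rdefect_approx x : rdefect x ->
  forall e : R, 0 < e -> exists h, fnorm (x - Dl h) <= e.
Proof.
move=> xK; have [y /orth_range_defect yD yx] := range_approx x bD.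
suff y0 : y = 0 by move=> e /yx; rewrite y0 subr0.
apply: inner_eq0; apply: small_eq0 => e e0.
have k0 : 0 < fnorm y + 1 by rewrite ltr_wpDl ?fnorm_ge0.
have [h Hh] := yx _ (divr_gt0 e0 k0).
have -> : inner y y = - inner y (x - y - Dl h).
  by rewrite !innerBr (xK _ yD) (rdefect_range h yD) !sub0r subr0 opprK.
rewrite normcN; apply: le_trans (inner_CS _ _) _.
by apply: le_mul_small; rewrite ?fnorm_ge0.
Qed.

Lemma rdefect_closed x :
  (forall e : R, 0 < e -> exists h, fnorm (x - Dl h) <= e) -> rdefect x.
Proof.
move=> xD y yD; apply: small_eq0 => e e0.
have k0 : 0 < fnorm y + 1 by rewrite ltr_wpDl ?fnorm_ge0.
have [h Hh] := xD _ (divr_gt0 e0 k0).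
have -> : inner y x = inner y (x - Dl h).
  by rewrite innerBr (rdefect_range h yD) subr0.
apply: le_trans (inner_CS _ _) _.
by apply: le_mul_small; rewrite ?fnorm_ge0.
Qed.

Lemma bop_ext_rdefect S T x : bounded_op S -> bounded_op T ->
  (forall h, S (Dl h) = T (Dl h)) -> rdefect x -> S x = T x.
Proof.
move=> bS bT ST xK.
apply: (@bop_ext_dense _ _ S T (fun x => exists h, x = Dl h)) => //.
  by move=> _ [h ->].
by move=> e /(rdefect_approx xK)[h Hh]; exists (Dl h) => //; exists h.
Qed.

(** Dl L_k and Dl have the same norm on every vector, so Dl h |-> Dl L_k h
    extends to the closed range. *)
Lemma wshift_exists : exists V : letter d -> H -> H, forall k,
  [/\ bounded_op (V k), forall h, V k (Dl h) = Dl (L k h) &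
      forall y, Dl y = 0 -> V k y = 0].
Proof.
suff : forall k, exists V : H -> H, [/\ bounded_op V, forall h,
  V (Dl h) = Dl (L k h) &
    forall y, Dl y = 0 -> V y = 0].
  by move=> HV; have [V VP] := choice HV; exists V.
move=> k; have [|V [bV _ VD V0]] := Douglas (bop_comp bD (shift_bop R k)) bD.
  by move=> h; rewrite /= fnorm_defect_shift.
by exists V; split=> // y /orth_range_defect; exact: V0.
Qed.

Definition wshift : letter d -> H -> H := sval (cid wshift_exists).
Local Notation V := wshift.

Lemma wshiftP k : [/\ bounded_op (V k), forall h, V k (Dl h) = Dl (L k h) &
  forall y, Dl y = 0 -> V k y = 0].
Proof. exact: (svalP (cid wshift_exists)). Qed.

Lemma wshift_bop k : bounded_op (V k). Proof. by case: (wshiftP k). Qed.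
Hint Resolve wshift_bop : core.

Lemma wshift_defect k h : V k (Dl h) = Dl (L k h).
Proof. by case: (wshiftP k). Qed.

Local Notation Z k := (adj (V k)).

Lemma wunshift_bop k : bounded_op (Z k). Proof. exact: adj_bop. Qed.
Hint Resolve wunshift_bop : core.

Lemma defect_wunshift k x : Dl (Z k x) = adj (L k) (Dl x).
Proof.
by apply: inner_ext => h; rewrite -defect_sa adjPr// wshift_defect defect_sa
  adjPr.
Qed.

Lemma wunshift_rdefect k x : rdefect (Z k x).
Proof.
by move=> y yD; rewrite adjPr//; have [_ _ /(_ _ yD) ->] := wshiftP k;
  rewrite inner0l.
Qed.

(** The Toeplitz property says that the transported shifts are isometries with
    orthogonal ranges. *)
Lemma wunshift_wshift j k x : rdefect x -> Z j (V k x) = (j == k)%:R *: x.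
Proof.
move=> xK.
have bS : bounded_op (Z j \o V k) by exact: bop_comp.
have bT : bounded_op (fun x : H => (j == k)%:R *: x).
  split=> [c f g|]; first by rewrite scalerDr !scalerA mulrC.
  by exists (normc (j == k)%:R) => h; rewrite fnormZ.
apply: (bop_ext_rdefect bS bT) => // h /=.
apply/eqP; rewrite -subr_eq0; apply/eqP; apply: rdefect_inj.
  rewrite -scaleNr addrC; apply: rdefect_lin; first exact: rdefect_range.
  exact: wunshift_rdefect.
by rewrite (bopB bD) defect_wunshift wshift_defect (bopZ bD) defect_toeplitz
  subrr.
Qed.

(** The backward shifts act on the range of the defect operator as on the Fock
    space, up to a multiple of one fixed vector. *)
Lemma wunshift_defect k h :
  Z k (Dl h) = h [::] *: Z k (Dl (delta R [::])) + Dl (adj (L k) h).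
Proof.
pose S1 h : H := Z k (Dl h).
pose S2 h : H := h [::] *: Z k (Dl (delta R [::])) + Dl (adj (L k) h).
have b1 : bounded_op S1 by exact: bop_comp (wunshift_bop k) bD.
have b2 : bounded_op S2.
  have bDL := bop_comp bD (adj_shift_bop R k); split=> [c f g|].
    rewrite /S2 coefD coefZ scalerDl scalerDr -scalerA.
    have /= -> := bopP bDL c f g.
    by rewrite !addrA; congr (_ + _); rewrite addrAC.
  have [M M0 HM] := bop_bound bDL.
  exists (fnorm (Z k (Dl (delta R [::]))) + M) => g.
  apply: le_trans (ler_fnormD _ _) _; rewrite mulrDl fnormZ mulrC.
  apply: lerD; last exact: HM.
  by rewrite ler_wpM2l ?fnorm_ge0// le_coef_fnorm.
have E : S1 = S2; last by rewrite -[LHS]/(S1 h) E.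
apply: bop_ext_delta => // -[|j w]; rewrite /S1 /S2 deltaE /=.
  by rewrite scale1r adj_shift_delta0 (bop0 bD) addr0.
rewrite scale0r add0r -shift_delta -wshift_defect wunshift_wshift.
  by rewrite adj_shift_shift (bopZ bD).
exact: rdefect_range.
Qed.

(** * The wandering vector *)

(** U is the component of Dl 1 orthogonal to all Dl p with p(0) = 0. The
    coefficients of Dl U on nonempty words are pairings of U with such vectors,
    so Dl U is a constant. *)
Lemma wandering_exists : exists U, [/\ rdefect U,
  Dl U = (fnorm U ^+ 2)%:C *: delta R [::] &
  forall e : R, 0 < e -> exists2 q : H, q [::] = 1 & fnorm (Dl q - U) <= e].
Proof.
have [||U [UP UD]] := @projection R d
    (fun s => exists2 p : H, p [::] = 0 & s = Dl p) (Dl (delta R [::])).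
- by exists 0 => //; rewrite (bop0 bD).
- move=> c _ _ [f f0 ->] [g g0 ->]; exists (c *: f + g);
  last by rewrite (bopP bD).
  by rewrite coefD coefZ f0 g0 mulr0 addr0.
have UA (e : R) : 0 < e -> exists2 q : H, q [::] = 1 & fnorm (Dl q - U) <= e.
  move=> /UD[_ [p p0 ->] Hp]; exists (delta R [::] - p);
    last by rewrite (bopB bD).
  by rewrite coefB p0 deltaE eqxx subr0.
exists U; split=> //.
  apply: rdefect_closed => e /UA[q _ Hq]; exists q; by rewrite fnormBC.
apply: fockP => w; rewrite -inner_delta -defect_sa coefZ deltaE.
case: w => [|k w] /=; last first.
  rewrite mulr0; apply: UP; exists (delta R (k :: w)) => //.
  by rewrite deltaE.
rewrite mulr1 -inner_ff; apply/eqP; rewrite -subr_eq0; apply/eqP.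
apply: small_eq0 => e e0.
have k0 : 0 < fnorm U + 1 by rewrite ltr_wpDl ?fnorm_ge0.
have [q q1 Hq] := UA _ (divr_gt0 e0 k0).
have E : inner (Dl (delta R [::])) U = inner (Dl q) U.
  apply/eqP; rewrite -subr_eq0 -innerBl -(bopB bD); apply/eqP/UP.
  by exists (delta R [::] - q) => //; rewrite coefB q1 deltaE eqxx subrr.
rewrite E -innerBl; apply: le_trans (inner_CS _ _) _.
by rewrite mulrC; apply: le_mul_small; rewrite ?fnorm_ge0.
Qed.

(** A finitely supported series without constant term is recovered from
    finitely many of its backward shifts. *)
Lemma first_letters (p : H) (s : seq (word d)) :
  (forall w, w \notin s -> p w = 0) -> p [::] = 0 ->
  exists2 F : seq (letter d), uniq F & p = \sum_(k <- F) L k (adj (L k) p).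
Proof.
move=> ps p0; pose F := undup (pmap ohead s).
have uF : uniq F by exact: undup_uniq.
exists F => //; apply: fockP => -[|j v]; rewrite coef_sum.
  by rewrite p0 big1// => k _; rewrite shift_nil.
under eq_bigr do rewrite shift_cons adj_shiftE.
have [jF|jF] := boolP (j \in F).
  rewrite (bigD1_seq j)//= eqxx mul1r big1 ?addr0// => k kj.
  by rewrite eq_sym (negbTE kj) mul0r.
rewrite ps.
  rewrite big_seq big1// => k kF; case: eqP => [jk|]; last by rewrite mul0r.
  by rewrite jk kF in jF.
apply: contra jF => js; rewrite mem_undup mem_pmap.
by apply/mapP; exists (j :: v).
Qed.

Section WanderingVector.
Variables (u : H) (a0 : R).
Hypotheses (a0_gt0 : 0 < a0) (u1 : fnorm u = 1) (uK : rdefect u).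
Hypothesis uD : Dl u = a0%:C *: delta R [::].
Hypothesis uA : forall e : R, 0 < e ->
  exists2 q : H, q [::] = 1 & fnorm (Dl q - a0%:C *: u) <= e.

Lemma wunshift_wandering k : Z k u = 0.
Proof.
apply: rdefect_inj; first exact: wunshift_rdefect.
by rewrite defect_wunshift uD (bopZ (adj_shift_bop R k)) adj_shift_delta0
  scaler0.
Qed.

Lemma inner_uu : inner u u = 1.
Proof. by rewrite inner_ff u1 expr1n. Qed.

Lemma inner_u_defect h : inner u (Dl h) = a0%:C * h [::].
Proof. by rewrite -defect_sa uD innerZl inner_delta conjc_real. Qed.

(* What is left of x after removing its components along u and along the
   ranges of finitely many of the isometries. *)
Let rest (F : seq (letter d)) x :=
  x - (inner u x *: u + \sum_(k <- F) V k (Z k x)).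

Let rest_u F x : inner u (rest F x) = 0.
Proof.
rewrite innerBr innerDr innerZr inner_uu mulr1 inner_sumr.
rewrite big1 ?addr0 ?subrr// => k _.
by rewrite -adjP// wunshift_wandering inner0l.
Qed.

Let Z_rest F x k : uniq F -> k \in F -> Z k (rest F x) = 0.
Proof.
move=> uF kF; rewrite (bopB (wunshift_bop k)) (bopD (wunshift_bop k)).
rewrite (bopZ (wunshift_bop k)) wunshift_wandering scaler0 add0r.
rewrite (bop_sum (wunshift_bop k)) (bigD1_seq k)//= big1; last first.
  move=> j jk; rewrite wunshift_wshift; last exact: wunshift_rdefect.
  by rewrite eq_sym (negbTE jk) scale0r.
rewrite wunshift_wshift; last exact: wunshift_rdefect.
by rewrite eqxx scale1r addr0 subrr.
Qed.

Let rest_orth F x c (z : letter d -> H) : uniq F ->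
  inner (rest F x) (c *: u + \sum_(k <- F) V k (z k)) = 0.
Proof.
move=> uF; rewrite innerDr innerZr innerC rest_u conjc0 mulr0 add0r.
rewrite inner_sumr big_seq big1// => k kF.
by rewrite -adjP// Z_rest// inner0l.
Qed.

Let fnorm_rest F x : uniq F -> fnorm (rest F x) ^+ 2 =
  fnorm x ^+ 2 - normc (inner u x) ^+ 2 - \sum_(k <- F) fnorm (Z k x) ^+ 2.
Proof.
move=> uF; apply: complexI;
  rewrite -inner_ff {2}/rest innerBr rest_orth// subr0.
rewrite !realcB rmorph_sum /= /rest innerBl innerDl innerZl inner_suml.
rewrite -normc_sqr -inner_ff opprD addrA; congr (_ - _).
by apply: eq_bigr => k _; rewrite -adjPr// inner_ff.
Qed.

Let rest_min F x c (z : letter d -> H) : uniq F ->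
  fnorm (rest F x) <= fnorm (x - (c *: u + \sum_(k <- F) V k (z k))).
Proof.
move=> uF.
have -> : x - (c *: u + \sum_(k <- F) V k (z k)) = rest F x +
   ((inner u x - c) *: u + \sum_(k <- F) V k (Z k x - z k)).
  have -> : \sum_(k <- F) V k (Z k x - z k) =
      \sum_(k <- F) V k (Z k x) - \sum_(k <- F) V k (z k).
    by rewrite -sumrB; apply: eq_bigr => k _; rewrite (bopB (wshift_bop k)).
  rewrite /rest; set p := \sum_(k <- F) _; set q := \sum_(k <- F) _.
  by apply: fockP => w; rewrite !(coefD, coefN, coefZ); ring.
by apply: fnorm_orth_le; exact: rest_orth.
Qed.

(** Every vector of the closed range is, up to a small error, of the form
    c Dl q + sum_k Dl L_k h_k with Dl q close to a multiple of the wandering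
      vector,
    so no mass escapes from the sum of the wandering line and the ranges of
    the isometries. *)
Lemma wold_step x : rdefect x ->
  ((fnorm x ^+ 2)%:E = (normc (inner u x) ^+ 2)%:E +
   \esum_(k in [set: letter d]) (fnorm (Z k x) ^+ 2)%:E)%E.
Proof.
move=> xK; apply/eqP; rewrite eq_le; apply/andP; split; last first.
  rewrite addeC -leeBrDr// -EFinB; apply: esum_le_seq => [k|F uF].
    by rewrite exprn_ge0 ?fnorm_ge0.
  have := exprn_ge0 2 (fnorm_ge0 (rest F x)); rewrite fnorm_rest//.
  by rewrite subr_ge0.
apply/lee_addgt0Pr => e e0.
pose t := Num.min 1 e; have t0 : 0 < t by rewrite lt_min ltr01.
have t3 : 0 < t / 3 by rewrite divr_gt0.
have [h Hh] := rdefect_approx xK t3.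
have k0 : 0 < normc (h [::]) + 1 by rewrite ltr_wpDl ?normc_ge0.
have [q q1 Hq] := uA (divr_gt0 t3 k0).
(* Dl h is h(0) Dl q, which is close to a multiple of u, plus Dl h2 with h2(0)
   = 0. *)
pose h2 := h - h [::] *: q.
have h20 : h2 [::] = 0 by rewrite coefB coefZ q1 mulr1 subrr.
have [s us Hs] := @cutoff_near R d h2 _ t3.
have [||F uF pE] := @first_letters (cutoff s h2) s.
- by move=> w ws; rewrite cutoffE// (negbTE ws).
- by rewrite cutoffE// h20; case: ifP.
have Hrest : fnorm (rest F x) <= t.
  apply: le_trans (@rest_min F x (h [::] * a0%:C)
    (fun k => Dl (adj (L k) (cutoff s h2))) uF) _.
  have -> : \sum_(k <- F) V k (Dl (adj (L k) (cutoff s h2))) = Dl (cutoff s h2).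
    by rewrite [in RHS]pE (bop_sum bD); apply: eq_bigr => k _;
      rewrite wshift_defect.
  have -> : x - ((h [::] * a0%:C) *: u + Dl (cutoff s h2)) =
      (x - Dl h) + (h [::] *: (Dl q - a0%:C *: u) + Dl (h2 - cutoff s h2)).
    rewrite (bopB bD) /h2 (bopB bD) (bopZ bD).
    set p := Dl (cutoff _ _); set p1 := Dl h; set p2 := Dl q.
    by apply: fockP => w; rewrite !(coefD, coefN, coefZ); ring.
  have H1 := defect_contractive (h2 - cutoff s h2).
  have H2 : fnorm (h [::] *: (Dl q - a0%:C *: u)) <= t / 3.
    by rewrite fnormZ; apply: le_mul_small; rewrite ?fnorm_ge0 ?normc_ge0.
  apply: le_trans (ler_fnormD _ _) _.
  apply: (@le_trans _ _ (t / 3 + (t / 3 + t / 3))); last by lra.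
  apply: lerD => //; apply: le_trans (ler_fnormD _ _) _; apply: lerD => //.
  exact: le_trans H1 (ltW Hs).
have t2 : fnorm (rest F x) ^+ 2 <= e.
  apply: le_trans (le_sqr (fnorm_ge0 _) Hrest) _.
  apply: (@le_trans _ _ (t * 1)); last by rewrite mulr1 ge_min lexx orbT.
  by rewrite expr2 ler_wpM2l ?(ltW t0)// ge_min lexx.
have HF := @seq_le_esum R _ (fun k => fnorm (Z k x) ^+ 2) F
  (fun k => exprn_ge0 2 (fnorm_ge0 _)) uF.
apply: (@le_trans _ _ ((normc (inner u x) ^+ 2)%:E +
   (\sum_(k <- F) fnorm (Z k x) ^+ 2)%:E + e%:E)%E); last first.
  by rewrite leeD2r// leeD2l.
rewrite -!EFinD lee_fin; move: t2; rewrite fnorm_rest//.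
set p := fnorm x ^+ 2; set r := normc _ ^+ 2; set sg := \sum_(k <- F) _.
lra.
Qed.

(** * Wold coefficients and the outer factor *)

(** The vectors V^w u form an orthonormal family. *)
Definition wold_basis w : H := foldr V u w.

Definition wold_mass (n : nat) x : \bar R :=
  \esum_(w in [set: word d])
    (if (size w < n)%N then normc (inner (wold_basis w) x) ^+ 2 else 0)%:E.

Lemma wold_mass0 x : wold_mass 0 x = 0%E.
Proof. by apply: esum1 => w _. Qed.

Lemma wold_massS n x : (wold_mass n.+1 x = (normc (inner u x) ^+ 2)%:E +
  \esum_(k in [set: letter d]) wold_mass n (Z k x))%E.
Proof.
rewrite /wold_mass esum_words => [|w]; last first.
  by rewrite lee_fin; case: ifP => // _; rewrite exprn_ge0 ?normc_ge0.
congr (_ + _)%E; apply: eq_esum => k _; apply: eq_esum => w _.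
by rewrite /size -/size ltnS adjPr.
Qed.

(** Iterating the Wold step n times exhausts the words of length below n and
    leaves a nonnegative remainder. *)
Lemma wold_bessel n x : rdefect x -> (wold_mass n x <= (fnorm x ^+ 2)%:E)%E.
Proof.
elim: n x => [|n IH] x xK.
  by rewrite wold_mass0 lee_fin exprn_ge0 ?fnorm_ge0.
rewrite wold_massS (wold_step xK) leeD2l//; apply: le_esum => k _.
exact/IH/wunshift_rdefect.
Qed.

(** Here the remainder of the n-fold Wold step vanishes: after n backward
    shifts x becomes orthogonal to the whole range of Dl. *)
Lemma wold_parseval n x : rdefect x ->
  (forall h, (forall w, (size w < n)%N -> h w = 0) -> inner (Dl h) x = 0) ->
  wold_mass n x = (fnorm x ^+ 2)%:E.
Proof.
elim: n x => [|n IH] x xK xh.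
  rewrite wold_mass0 (_ : x = 0) ?fnorm0 ?expr0n//.
  apply: rdefect_inj => //; apply: inner_ext => h.
  by rewrite inner0r -defect_sa xh.
rewrite wold_massS (wold_step xK); congr (_ + _)%E; apply: eq_esum => k _.
apply: IH => [|h hn]; first exact: wunshift_rdefect.
rewrite adjPr// wshift_defect xh// => -[|j w] wn; first by rewrite shift_nil.
by rewrite shift_cons hn// mulr0.
Qed.

Lemma wold_seq_le (s : seq (word d)) x : rdefect x -> uniq s ->
  \sum_(w <- s) normc (inner (wold_basis w) x) ^+ 2 <= fnorm x ^+ 2.
Proof.
move=> xK us; pose n := \max_(w <- s) (size w).+1.
have := wold_bessel n xK; rewrite -lee_fin; apply: le_trans.
apply: le_trans (seq_le_esum _ us); last first.
  by move=> w; case: ifP => // _; rewrite exprn_ge0 ?normc_ge0.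
rewrite lee_fin big_seq [leRHS]big_seq; apply: ler_sum => w ws.
by rewrite (@leq_bigmax_seq _ _ xpredT (fun w : word d =>
  (size w).+1) w ws isT).
Qed.

(** The backward shifts act on Dl h as on h up to the multiple h(0) of the
    backward shifts of Dl 1, so removing the letters of w one by one collects
    one term for each prefix of w. *)
Lemma wold_coef w h : inner (wold_basis w) (Dl h) =
  \sum_(j < (size w).+1)
    h (take j w) * inner (wold_basis (drop j w)) (Dl (delta R [::])).
Proof.
elim: w h => [|k w IH] h.
  by rewrite big_ord1 /= !inner_u_defect deltaE eqxx mulr1 mulrC.
rewrite big_ord_recl take0 drop0 /= -!adjPr//.
rewrite wunshift_defect innerDr innerZr; congr (_ + _).
by rewrite IH; apply: eq_bigr => j _; rewrite adj_shiftE.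
Qed.

(** The words are reversed so that right multiplication by the transpose, which
    is what F(R) is, sends h to the family of Wold coefficients of Dl h. *)
Definition wold_series : fseries R d :=
  fun w => inner (wold_basis (rev w)) (Dl (delta R [::])).

Lemma smul_wold_series h w :
  smul wold_series h w = inner (wold_basis (rev w)) (Dl (Ut h)).
Proof.
rewrite wold_coef size_rev (reindex_inj rev_ord_inj) /smul /=.
apply: eq_bigr => -[j jw] _ /=; rewrite ltnS in jw; rewrite subSS UtE.
by rewrite take_rev drop_rev revK subKn// mulrC /wold_series.
Qed.

Lemma wold_series_bound h s : uniq s ->
  \sum_(w <- s) normc (smul wold_series h w) ^+ 2 <= fnorm (Dl (Ut h)) ^+ 2.
Proof.
move=> us; have usr : uniq (map rev s).
  by rewrite map_inj_uniq//; exact: (can_inj revK).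
apply: le_trans (wold_seq_le (@rdefect_range (Ut h)) usr); rewrite big_map.
by apply: ler_sum => w _; rewrite smul_wold_series.
Qed.

Lemma wold_unit_ball : unit_ball wold_series.
Proof.
have [|mA HA] := @multiplierI R d wold_series 1.
  move=> h s us; rewrite mul1r; apply: le_trans (wold_series_bound h us) _.
  apply: le_sqr; rewrite ?fnorm_ge0// -[leRHS]fnorm_Ut.
  exact: defect_contractive.
split=> // h; apply: le_of_sqr; rewrite ?fnorm_ge0//.
by rewrite -[leRHS]mul1r.
Qed.

Local Notation A := (rmul wold_series).
Let mA : multiplier wold_series. Proof. by case: wold_unit_ball. Qed.
Let bA : bounded_op A. Proof. exact: rmul_bop. Qed.

Lemma rmul_wold_series h w : A h w = inner (wold_basis w) (Dl h).
Proof.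
rewrite rmulE// wold_coef; apply: eq_bigr => j _.
by rewrite /transpose /wold_series revK.
Qed.

Lemma rmul_wold_le h : fnorm (A h) <= fnorm (Dl h).
Proof.
apply: le_of_sqr; rewrite ?fnorm_ge0//; apply: fnorm_bound => s us.
apply: le_trans (wold_seq_le (@rdefect_range h) us).
by apply: ler_sum => w _; rewrite rmul_wold_series.
Qed.

Lemma wold_basis_u w : inner (wold_basis w) u = (w == [::])%:R.
Proof.
case: w => [|k w] /=; first exact: inner_uu.
by rewrite -adjPr// wunshift_wandering inner0r.
Qed.

(** Multiplying a vector q with Dl q close to a0 u produces nearly the constant
    a0, so a vector orthogonal to the range has no constant term; the
    backward shifts preserve orthogonality to the range. *)
Lemma wold_range_orth y : orth_range A y -> y = 0.
Proof.
move=> yA; apply: fockP => w; rewrite coef0; elim: w y yA => [|k w IH] y yA.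
  suff : a0%:C * y [::] = 0.
    move=> /eqP; rewrite mulf_eq0 => /orP[/eqP/complexI a00|/eqP//].
    by move: a0_gt0; rewrite a00 ltxx.
  apply: small_eq0 => e e0.
  have k0 : 0 < fnorm y + 1 by rewrite ltr_wpDl ?fnorm_ge0.
  have [q q1 Hq] := uA (divr_gt0 e0 k0).
  have Aq : fnorm (A q - a0%:C *: delta R [::]) <= e / (fnorm y + 1).
    apply: le_trans Hq; apply: le_of_sqr; rewrite ?fnorm_ge0//.
    apply: fnorm_bound => s us.
    have xK : rdefect (Dl q - a0%:C *: u).
      rewrite -scaleNr addrC; apply: rdefect_lin => //; exact: rdefect_range.
    apply: le_trans (wold_seq_le xK us); apply: ler_sum => w _.
    rewrite coefB coefZ deltaE rmul_wold_series innerBr innerZr wold_basis_u.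
    by [].
  have -> : a0%:C * y [::] = - inner (A q - a0%:C *: delta R [::]) y.
    by rewrite innerBl yA innerZl inner_delta conjc_real sub0r opprK.
  rewrite normcN; apply: le_trans (inner_CS _ _) _.
  by rewrite mulrC; apply: le_mul_small; rewrite ?fnorm_ge0.
rewrite -adj_shiftE; apply: IH => h; rewrite adjPr//.
by rewrite -(rmul_shift k h mA) yA.
Qed.

Lemma wold_outer : outer wold_series.
Proof.
split=> // f e e0; have [y yA yf] := range_approx f bA.
have e20 : 0 < e / 2 by rewrite divr_gt0.
have [h Hh] := yf _ e20; exists h; apply: le_lt_trans (_ : e / 2 < e);
  last by lra.
by rewrite (wold_range_orth yA) subr0 in Hh.
Qed.

(** The coefficients of e_i(R) h on words of length below n do not change when
    h is modified in degrees n and above, so they are controlled by the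
    distance of Dl h to the vectors Dl r with r of that kind; by the Wold
    decomposition this distance is the mass of the first Wold coefficients of
    Dl h, which are coefficients of a(R) h. *)
Lemma wold_maximal (m : nat) (e : 'I_m -> fseries R d) :
  (forall i, multiplier (e i)) ->
  (forall h, \sum_i fnorm (rmul (e i) h) ^+ 2 <= fnorm (Dl h) ^+ 2) ->
  forall h, \sum_i fnorm (rmul (e i) h) ^+ 2 <= fnorm (A h) ^+ 2.
Proof.
move=> me He h; apply/ler_addgt0Pr => e1 e10.
have m0 : 0 < m%:R + 1 :> R by rewrite ltr_wpDl.
have Hs i : exists s : seq (word d), uniq s /\
    fnorm (rmul (e i) h) ^+ 2 - e1 / (m%:R + 1) <=
    \sum_(w <- s) normc (rmul (e i) h w) ^+ 2.
  have [s us /ltW Hs] := seq_near_fnorm (rmul (e i) h) (divr_gt0 e10 m0).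
  by exists s.
have [s Hs'] := choice Hs.
(* All the words in the finite sets s i are shorter than n. *)
pose n := \max_(i < m) \max_(w <- s i) (size w).+1.
have sn i w : w \in s i -> (size w < n)%N.
  move=> ws; apply: leq_trans (leq_bigmax i).
  exact: (@leq_bigmax_seq _ _ xpredT (fun w : word d => (size w).+1) w ws isT).
have [||y [yP yD]] := @projection R d
  (fun x => exists2 r : H, (forall w,
    (size w < n)%N -> r w = 0) & x = Dl r) (Dl h).
- by exists 0 => //; rewrite (bop0 bD).
- move=> c _ _ [f f0 ->] [g g0 ->]; exists (c *: f + g);
  last by rewrite (bopP bD).
  by move=> w wn; rewrite coefD coefZ f0// g0// mulr0 addr0.
have yP' (r : H) : (forall w, (size w < n)%N -> r w = 0) -> inner (Dl r) y = 0.
  by move=> rn; apply: yP; exists r.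
have yK : rdefect y.
  apply: rdefect_closed => t /yD[_ [r rn ->] Hr]; exists (h - r).
  by rewrite fnormBC (bopB bD).
have Arn (r : H) w : (forall w, (size w < n)%N -> r w = 0) -> (size w < n)%N ->
    inner (wold_basis w) (Dl r) = 0.
  move=> rn wn; rewrite wold_coef big1// => -[j jw] _ /=.
  rewrite rn ?mul0r//; apply: leq_ltn_trans wn; rewrite size_take.
  by case: ifP => // jw'; exact: ltnW.
have yA : fnorm y ^+ 2 <= fnorm (A h) ^+ 2.
  rewrite -lee_fin -(wold_parseval yK yP') fnorm_sqr; apply: le_esum => w _.
  rewrite lee_fin; case: ifP => wn; last by rewrite exprn_ge0 ?normc_ge0.
  rewrite rmul_wold_series.
  suff -> : inner (wold_basis w) y = inner (wold_basis w) (Dl h) by [].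
  apply/eqP; rewrite -subr_eq0; apply/eqP; apply: small_eq0 => t t0.
  have k0 : 0 < fnorm (wold_basis w) + 1 by rewrite ltr_wpDl ?fnorm_ge0.
  have [_ [r rn ->] Hr] := yD _ (divr_gt0 t0 k0).
  have -> : inner (wold_basis w) y - inner (wold_basis w) (Dl h) =
      - inner (wold_basis w) (Dl h - Dl r - y).
    by rewrite (innerBr _ (Dl h - Dl r)) (innerBr _ (Dl h)) (Arn r w rn wn)
      subr0 opprB.
  rewrite normcN; apply: le_trans (inner_CS _ _) _.
  by apply: le_mul_small; rewrite ?fnorm_ge0.
have eh i (r : H) : (forall w, (size w < n)%N -> r w = 0) ->
    \sum_(w <- s i) normc (rmul (e i) h w) ^+ 2 <= fnorm (rmul (e i) (h - r))
      ^+ 2.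
  move=> rn; apply: le_trans (seq_le_fnorm _ (Hs' i).1).
  rewrite le_eqVlt; apply/orP; left; apply/eqP/eq_big_seq => w ws.
  apply/esym/(congr1 (fun z : R[i] => normc z ^+ 2)).
  apply: (bop_coef_sub (rmul_bop (me i))).
  rewrite rmulE// big1// => -[j jw] _ /=; rewrite rn ?mul0r//.
  apply: leq_ltn_trans (sn i w ws); rewrite size_take.
  by case: ifP => // jw'; exact: ltnW.
have sumle : \sum_(i < m) \sum_(w <- s i) normc (rmul (e i) h w) ^+ 2 <=
    fnorm (A h) ^+ 2.
  apply: le_trans yA; apply: le_sqr_approx => [|t t0]; first exact: fnorm_ge0.
  have [_ [r rn ->] Hr] := yD _ t0.
  apply: (@le_trans _ _ (fnorm (Dl (h - r)) ^+ 2)).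
    by apply: le_trans (He (h - r)); apply: ler_sum => i _; exact: eh.
  apply: le_sqr; first exact: fnorm_ge0.
  rewrite (bopB bD); have := ler_fnormD (Dl h - Dl r - y) y; rewrite subrK; lra.
apply: (@le_trans _ _ (\sum_(i < m)
    (\sum_(w <- s i) normc (rmul (e i) h w) ^+ 2 + e1 / (m%:R + 1)))).
  by apply: ler_sum => i _; rewrite -lerBlDr; exact: (Hs' i).2.
rewrite big_split /= sumr_const card_ord; apply: lerD => //.
by rewrite -[leLHS]mulr_natl; apply: le_mul_small => //; rewrite divr_ge0 ?ltW.
Qed.

Lemma wold_inf (q : H) : q [::] = 1 -> a0 <= fnorm (Dl q).
Proof.
move=> q1; have := inner_CS u (Dl q).
by rewrite inner_u_defect q1 mulr1 normc_real u1 mul1r ger0_norm// ltW.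
Qed.

End WanderingVector.
End Wold.

(** * The complementary space of a contraction *)

Lemma word_op_cons (R : realType) (d : option nat)
    (T : letter d -> fock R d -> fock R d) k w x :
  word_op T (k :: w) x = T k (word_op T w x).
Proof. by []. Qed.

Section ComplementarySpace.
Variables (R : realType) (d : option nat).
Local Notation H := (fock R d).
Local Notation L := (@shift R d).
Local Notation one := (delta R [::] : H).
Implicit Types (f g h x y : H) (w : word d).

Variable B : H -> H.
Hypotheses (bB : bounded_op B) (cB : contractive B).
Hypothesis BL : forall k h, B (L k h) = L k (B h).

Let X h : H := adj B (B h).
Let X' h : H := B (adj B h).

Let bX : bounded_op X. Proof. exact: bop_comp (adj_bop bB) bB. Qed.
Let bX' : bounded_op X'. Proof. exact: bop_comp bB (adj_bop bB). Qed.
Let cX : contractive X.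
Proof. by move=> h; apply: le_trans (cB h); exact: adj_contractive. Qed.
Let cX' : contractive X'.
Proof. by move=> h; apply: le_trans (adj_contractive bB cB h); exact: cB. Qed.
Let sX : self_adjoint X.
Proof. by move=> f g; rewrite /X adjP// adjPr. Qed.
Let sX' : self_adjoint X'.
Proof. by move=> f g; rewrite /X' -(adjPr bB) (adjP bB). Qed.

Definition codefect_sqrt : H -> H := psqrt X.
Local Notation Dl := codefect_sqrt.

Definition defect_sqrt : H -> H := sqrt_op (fun h => h - B (adj B h)).
Local Notation D := defect_sqrt.

Lemma codefect_sqrt_pos : positive_op Dl.
Proof. exact: psqrt_positive. Qed.
Let Dl_pos := codefect_sqrt_pos.
Let bDl : bounded_op Dl. Proof. by case: Dl_pos. Qed.

Lemma codefect_sqrtK h : Dl (Dl h) = h - adj B (B h).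
Proof. exact: psqrtK. Qed.
Let DlK := codefect_sqrtK.

(** Positive square roots are unique, so the chosen one is the limit of the
    iteration and inherits its intertwining properties. *)
Lemma defect_sqrtE : D = psqrt X'.
Proof.
have Hex : exists S, positive_op S /\ S \o S = (fun h => h - X' h).
  exists (psqrt X'); split; first exact: psqrt_positive.
  by apply/funext => h; exact: psqrtK.
have [pD DD] : positive_op D /\ D \o D = (fun h => h - X' h).
  exact: (@xgetPex _ (fun=> 0)
    [set S | positive_op S /\ S \o S = (fun h => h - X' h)] Hex).
have {}DD h : D (D h) = h - X' h by exact: (congr1 (fun T : H -> H => T h) DD).
have [bD _] := pD.
have DX h : D (X' h) = X' (D h).
  have XE g : X' g = g - D (D g) by rewrite DD opprB addrC subrK.
  by rewrite !XE (bopB bD).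
apply: (positive_sqrt_unique pD); first exact: psqrt_positive.
  by move=> h; rewrite DD psqrtK.
exact: psqrt_intertwine.
Qed.

Let pD : positive_op D. Proof. by rewrite defect_sqrtE;
  exact: psqrt_positive. Qed.
Let bD : bounded_op D. Proof. by case: pD. Qed.
Let sD : self_adjoint D. Proof. exact: positive_sa. Qed.
Let sDl : self_adjoint Dl. Proof. exact: positive_sa. Qed.
Let DK h : D (D h) = h - B (adj B h).
Proof. by rewrite defect_sqrtE; exact: psqrtK. Qed.

Lemma defect_intertwine h : B (Dl h) = D (B h).
Proof. by rewrite defect_sqrtE; exact: psqrt_intertwine. Qed.

Lemma adj_defect_intertwine h : Dl (adj B h) = adj B (D h).
Proof.
by apply: inner_ext => f; rewrite adjPr// -sDl adjPr// defect_intertwine sD.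
Qed.

(** The vector of least norm that D maps to f. *)
Definition coisometry_lift f : H :=
  xget 0 [set g | D g = f /\ forall k, D k = 0 -> inner k g = 0].
Local Notation lift := coisometry_lift.

(** D (D f + B x) = f - B B^* f + B Dl x, since D B = B Dl. *)
Lemma coisometry_liftE f x : adj B f = Dl x -> rdefect Dl x ->
  lift f = D f + B x.
Proof.
move=> fx xK.
pose P g := D g = f /\ forall k, D k = 0 -> inner k g = 0.
have PE : P (D f + B x).
  split; first by rewrite (bopD bD) DK fx -defect_intertwine subrK.
  move=> k kD; rewrite innerDr -sD kD inner0l add0r -adjP//.
  by apply: xK; rewrite adj_defect_intertwine kD (bop0 (adj_bop bB)).
have [D1 O1] : P (lift f).
  exact: (@xgetPex _ 0 [set g | P g] (ex_intro _ _ PE)).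
have [D2 O2] := PE.
apply/eqP; rewrite -subr_eq0; apply/eqP/inner_eq0.
have k0 : D (lift f - (D f + B x)) = 0 by rewrite (bopB bD) D1 D2 subrr.
by rewrite innerBr O1// O2// subrr.
Qed.

(** The norm of the complementary space is the ambient norm plus the norm of a
    preimage of B^* f under the defect operator of B. *)
Lemma coisometry_innerE f f' x x' : adj B f = Dl x -> rdefect Dl x ->
  adj B f' = Dl x' -> rdefect Dl x' ->
  inner (lift f) (lift f') = inner f f' + inner x x'.
Proof.
move=> fx xK fx' xK'; rewrite (coisometry_liftE fx xK) (coisometry_liftE fx'
  xK').
rewrite innerDl !innerDr sD DK innerBr -(adjP bB f (adj B f')) fx fx'.
rewrite (sD f) -defect_intertwine -(adjP bB f) fx.
rewrite -(sD (B x)) -defect_intertwine -(adjPr bB (Dl x)) fx'.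
rewrite -(adjPr bB x) -/(X x').
have -> : X x' = x' - Dl (Dl x') by rewrite DlK opprB addrC subrK.
by rewrite innerBr -(sDl x); ring.
Qed.

Lemma coisometry_normE f x : adj B f = Dl x -> rdefect Dl x ->
  fnorm (lift f) ^+ 2 = fnorm f ^+ 2 + fnorm x ^+ 2.
Proof.
move=> fx xK; apply: complexI; rewrite realcD -!inner_ff.
exact: coisometry_innerE.
Qed.

Lemma adj_rmul_shift k h : adj B (adj (L k) h) = adj (L k) (adj B h).
Proof. by apply: inner_ext => f; rewrite !adjPr// BL. Qed.

Section Wandering.
Variables (u : H) (a0 : R).
Hypotheses (a0_gt0 : 0 < a0) (u1 : fnorm u = 1) (uK : rdefect Dl u).
Hypothesis uD : Dl u = a0%:C *: one.
Hypothesis uA : forall e : R, 0 < e ->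
  exists2 q : H, q [::] = 1 & fnorm (Dl q - a0%:C *: u) <= e.

Local Notation A := (wold_series bB BL Dl_pos DlK u).
Local Notation V := (wshift bB BL Dl_pos DlK).
Local Notation Z k := (adj (V k)).

Let bV k : bounded_op (V k). Proof. exact: wshift_bop. Qed.

Let bt := B one.

(* As Dl u = a0, the vector u / a0 is a preimage of 1 under Dl. *)
Let v0 := a0^-1%:C *: u - Dl one.

Let v0D : adj B bt = Dl v0.
Proof.
rewrite (bopB bDl) (bopZ bDl) uD scalerA -realcM mulVf ?lt0r_neq0// scale1r.
by rewrite DlK opprB addrC subrK.
Qed.

Let v0K : rdefect Dl v0.
Proof.
rewrite /v0 -[- Dl one]scaleN1r addrC; apply: rdefect_lin.
  exact: rdefect_range.
by rewrite -[X in rdefect _ X]addr0; apply: rdefect_lin => // y _;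
  rewrite inner0r.
Qed.

(** For w empty this is B^* b^t = 1 - Dl (Dl 1). The backward shifts kill the
    constant 1. *)
Lemma adj_word w :
  adj B (word_op (fun k => adj (L k)) w bt) =
  (w == [::])%:R *: one - Dl (word_op (fun k => Z k) w (Dl one)).
Proof.
elim: w => [|k w IH]; first by rewrite scale1r DlK opprB addrC subrK.
rewrite !word_op_cons adj_rmul_shift IH (bopB (adj_shift_bop R k)).
rewrite (bopZ (adj_shift_bop R k)) adj_shift_delta0 scaler0 scale0r.
by rewrite defect_wunshift.
Qed.

(** The preimage under Dl needed to evaluate the complementary inner product at
    the backward shifts of b^t. *)
Lemma adj_rmul_word w : w != [::] ->
  adj B (word_op (fun k => adj (L k)) w bt) =
  Dl (- word_op (fun k => Z k) w (Dl one)).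
Proof.
by move=> w0; rewrite adj_word (negbTE w0) scale0r sub0r (bopN bDl).
Qed.

Lemma word_rdefect w : rdefect Dl (- word_op (fun k => Z k) w (Dl one)).
Proof.
have xK : rdefect Dl (word_op (fun k => Z k) w (Dl one)).
  case: w => [|k w] /=; [exact: rdefect_range|exact: wunshift_rdefect].
by move=> y yD; rewrite innerNr xK// oppr0.
Qed.

Lemma wold_basis_rev w x :
  inner (wold_basis bB BL Dl_pos DlK u (rev w)) x =
  inner u (word_op (fun k => Z k) w x).
Proof.
rewrite /wold_basis; elim: w u => [|k w IH] y //.
by rewrite rev_cons foldr_rcons IH adjPr.
Qed.

(** As b^t = B 1, the Fock space pairing of b^t with its backward shift equals
    minus the pairing of Dl 1 with its own backward shift, and it cancels the
    contribution of - Dl 1; what remains is the Wold coefficient of Dl 1. *)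
Lemma coisometry_inner_word w : w != [::] ->
  inner (lift bt) (lift (word_op (fun k => adj (L k)) w bt)) = - a0^-1%:C * A w.
Proof.
move=> w0.
rewrite (coisometry_innerE v0D v0K (adj_rmul_word w0) (@word_rdefect w)).
rewrite -(adjPr bB one) (adj_rmul_word w0) (bopN bDl) !innerNr innerBl innerZl.
rewrite conjc_real -(sDl one) /wold_series wold_basis_rev; ring.
Qed.

(** The squared norm of L_k^* b^t in the complementary space is |L_k^* b^t|^2
    in the Fock space plus |Z_k Dl 1|^2. The first terms sum to |b^t|^2 -
    |b(0)|^2, the second ones to |Dl 1|^2 - a0^2 by the Wold step, and |Dl 1|^2
    = 1 - |b^t|^2. *)
Lemma coisometry_sum : (1 - (normc (bt [::]) ^+ 2)%:E -
  \esum_(k in [set: letter d]) (fnorm (lift (adj (L k) bt)) ^+ 2)%:E =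
  (a0 ^+ 2)%:E)%E.
Proof.
have -> : \esum_(k in [set: letter d]) (fnorm (lift (adj (L k) bt)) ^+ 2)%:E =
   (\esum_(k in [set: letter d]) (fnorm (adj (L k) bt) ^+ 2)%:E +
    \esum_(k in [set: letter d]) (fnorm (Z k (Dl one)) ^+ 2)%:E)%E.
  rewrite -esumD; try by move=> k _; rewrite lee_fin exprn_ge0 ?fnorm_ge0.
  apply: eq_esum => k _; rewrite -EFinD; congr _%:E.
  rewrite -(fnormN (Z k (Dl one))); apply: coisometry_normE.
    exact: (@adj_rmul_word [:: k]).
  exact: (@word_rdefect [:: k]).
have := wold_step bB BL Dl_pos DlK u1 uD uA (@rdefect_range _ _ _ Dl_pos one).
have := fnorm_words bt.
have -> : inner u (Dl one) = a0%:C.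
  by rewrite (inner_u_defect Dl_pos uD) deltaE eqxx mulr1.
have -> : fnorm (Dl one) ^+ 2 = 1 - fnorm bt ^+ 2.
  by rewrite (fnorm_defect bB Dl_pos DlK) fnorm_delta expr1n.
rewrite normc_real real_normK ?num_real//.
set S1 := esum _ _; set S2 := esum _ _; set p := fnorm bt ^+ 2.
have S10 : (0 <= S1)%E by apply: esum_ge0 => k _;
  rewrite lee_fin exprn_ge0 ?fnorm_ge0.
have S20 : (0 <= S2)%E by apply: esum_ge0 => k _;
  rewrite lee_fin exprn_ge0 ?fnorm_ge0.
case: S1 S10 => [s1| |] // _; case: S2 S20 => [s2| |] //= _.
by move=> [H1] [H2]; congr _%:E; lra.
Qed.

End Wandering.
End ComplementarySpace.

(** * The companion series *)

Section Companion.
Variables (R : realType) (d : option nat) (b : fseries R d).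
Hypothesis b_ball : unit_ball b.
Local Notation H := (fock R d).
Local Notation one := (delta R [::] : H).
Implicit Types (f g h x y : H) (w : word d).

Lemma unit_ball_multiplier : multiplier b. Proof. by case: b_ball. Qed.
Let mb := unit_ball_multiplier.

Lemma unit_ball_contractive : contractive (rmul b).
Proof. by move=> h; rewrite fnorm_rmul -[leRHS]fnorm_Ut; case: b_ball. Qed.

Lemma transpose_rmul : to_fock (transpose b) = rmul b one.
Proof.
have bS : b \in @square_summable R d.
  have [bS _] := mb; have := bS one; rewrite (_ : smul b one = b)//.
  apply/funext => w; rewrite /smul big_ord_recr /= take_size drop_size.
  rewrite deltaE eqxx mulr1 big1 ?add0r// => -[j jw] _ /=.
  by rewrite deltaE -size_eq0 size_drop subn_eq0 leqNgt jw mulr0.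
apply: fockP => w; rewrite rmul_delta0// to_fockE//.
exact: transpose_square_summable.
Qed.

Let bB := rmul_bop mb.
Let cB := unit_ball_contractive.
Let BL k h := rmul_shift k h mb.
Let Dl_pos := codefect_sqrt_pos bB cB.
Let DlK := codefect_sqrtK bB cB.
Local Notation Dl := (codefect_sqrt (rmul b)).

Section CompanionFormula.
Variables (u : H) (a0 : R).
Hypotheses (a0_gt0 : 0 < a0) (u1 : fnorm u = 1) (uK : rdefect Dl u).
Hypothesis uD : Dl u = a0%:C *: one.
Hypothesis uA : forall e : R, 0 < e ->
  exists2 q : H, q [::] = 1 & fnorm (Dl q - a0%:C *: u) <= e.

Lemma companion0_sqE : companion0_sq b = (a0 ^+ 2)%:E.
Proof.
rewrite /companion0_sq transpose_rmul.
have -> : b [::] = rmul b one [::] by rewrite rmul_delta0.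
exact: (coisometry_sum bB cB BL u1 uD uA).
Qed.

Lemma companionE : companion b = wold_series bB BL Dl_pos DlK u.
Proof.
have a0E : Num.sqrt (fine (companion0_sq b)) = a0.
  by rewrite companion0_sqE /= sqrtr_sqr ger0_norm ?ltW.
apply/funext => w; rewrite /companion a0E transpose_rmul.
case: w => [|k w].
  by rewrite /wold_series /= (inner_u_defect Dl_pos uD) deltaE eqxx mulr1.
have E := coisometry_inner_word bB cB BL a0_gt0 uK uD (isT : k :: w != [::]).
rewrite -[dBR_inner _ _ _]/(inner (coisometry_lift (rmul b) _) (coisometry_lift
  (rmul b) _)).
rewrite E mulrA mulNr mulrN opprK -realcM mulfV ?lt0r_neq0//.
by rewrite mul1r.
Qed.

End CompanionFormula.
End Companion.

(** * Columns and the role of extremality *)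

Section Columns.
Variables (R : realType) (d : option nat).
Local Notation H := (fock R d).
Implicit Types (h : H) (w : word d).

(** The coefficients of e(R) q of lowest degree are those of e^t, times the
    constant term of q; hence a nonzero e(R) cannot be small on vectors with
    constant term 1, and the infimum defining the wandering vector is positive.
      *)
Lemma wandering_neq0 (Dl : H -> H) (e : fseries R d) (U : H) : multiplier e ->
  (exists w, e w != 0) ->
  (forall h, fnorm (rmul e h) <= fnorm (Dl h)) ->
  (forall t : R, 0 < t -> exists2 q : H, q [::] = 1 & fnorm (Dl q - U) <= t) ->
  U != 0.
Proof.
move=> me [w ew] eD UA; apply/eqP => U0.
have ex : exists n, `[< exists v, size v = n /\ transpose e v != 0 >].
  by exists (size w); apply/asboolP; exists (rev w);
    rewrite size_rev /transpose revK.
(* n is the least degree in which e^t does not vanish. *)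
case: (ex_minnP ex) => n /asboolP[v [vn ev]] vmin.
have low v' : (size v' < n)%N -> transpose e v' = 0.
  move=> v'n; apply/eqP; apply: contraLR v'n => ev'; rewrite -leqNgt.
  by apply: vmin; apply/asboolP; exists v'.
suff ev0 : transpose e v = 0 by move: ev; rewrite ev0 eqxx.
apply: small_eq0 => t t0; have [q q1 Hq] := UA _ t0.
have <- : rmul e q v = transpose e v.
  rewrite rmulE// big_ord_recl take0 drop0 q1 mul1r big1 ?addr0// => -[j jv] _.
  rewrite /= low ?mulr0// size_drop vn.
  by case: v vn jv {ev} => [//|? ? <-] jv; rewrite ltn_subrL.
apply: le_trans (le_coef_fnorm _ _) _; apply: le_trans (eD q) _.
by rewrite U0 subr0 in Hq.
Qed.

Lemma sum_col_mx (T : Type) (m n : nat) (c : 'cV[T]_m) (e : 'cV[T]_n)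
    (F : T -> R) :
  \sum_i F (col_mx c e i 0) = \sum_i F (c i 0) + \sum_i F (e i 0).
Proof.
by rewrite big_split_ord /=; congr (_ + _); apply: eq_bigr => i _;
  rewrite ?col_mxEu ?col_mxEd.
Qed.

Lemma column_sum (m n : nat) (c : 'cV[fseries R d]_m)
    (e : 'cV[fseries R d]_n) h :
  \sum_i fnorm (lmul (col_mx c e i 0) h) ^+ 2 =
  \sum_i fnorm (lmul (c i 0) h) ^+ 2 + \sum_i fnorm (lmul (e i 0) h) ^+ 2.
Proof. exact: (sum_col_mx c e (fun F => fnorm (lmul F h) ^+ 2)). Qed.

Lemma sum_const_col (T : Type) (x : T) (F : T -> R) :
  \sum_i F ((const_mx x : 'cV[T]_1) i 0) = F x.
Proof. by rewrite big_ord1 mxE. Qed.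

Lemma sum_const_pair (T : Type) (x y : T) (F : T -> R) :
  \sum_i F (col_mx (const_mx x : 'cV[T]_1) (const_mx y : 'cV[T]_1) i 0) =
  F x + F y.
Proof. by rewrite sum_col_mx !sum_const_col. Qed.

Lemma column_const (a : fseries R d) h :
  \sum_i fnorm (lmul ((const_mx a : 'cV[fseries R d]_1) i 0) h) ^+ 2 =
  fnorm (lmul a h) ^+ 2.
Proof. exact: (sum_const_col a (fun F => fnorm (lmul F h) ^+ 2)). Qed.

Lemma column_const_pair (a b : fseries R d) h :
  \sum_i fnorm (lmul (col_mx (const_mx a : 'cV[fseries R d]_1)
    (const_mx b : 'cV[fseries R d]_1) i 0) h) ^+ 2 =
  fnorm (lmul a h) ^+ 2 + fnorm (lmul b h) ^+ 2.
Proof. exact: (sum_const_pair a b (fun F => fnorm (lmul F h) ^+ 2)). Qed.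

Lemma const_col_multiplier (a : fseries R d) : multiplier a ->
  column_multiplier (const_mx a : 'cV[fseries R d]_1).
Proof. by move=> ma i; rewrite mxE. Qed.

Lemma col_mx_multiplier (m n : nat) (c : 'cV[fseries R d]_m)
    (e : 'cV[fseries R d]_n) :
  column_multiplier c -> column_multiplier e -> column_multiplier (col_mx c e).
Proof.
by move=> mc me i; case: (split_ordP i) => j ->;
  [rewrite col_mxEu|rewrite col_mxEd].
Qed.

(** A contractive column with entries b and e says that e(R)^* e(R) is
    dominated by 1 - b(R)^* b(R). *)
Lemma nonCE_minorant (b : fseries R d) (Dl : H -> H) : unit_ball b ->
  (forall h, fnorm (Dl h) ^+ 2 = fnorm h ^+ 2 - fnorm (rmul b h) ^+ 2) ->
  ~ column_extreme (const_mx b : 'cV[fseries R d]_1) ->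
  exists e : fseries R d, [/\ multiplier e, exists w, e w != 0 &
    forall h, fnorm (rmul e h) <= fnorm (Dl h)].
Proof.
move=> b_ball DlE nCE; apply: contrapT => He; apply: nCE; split.
- by apply: const_col_multiplier; case: b_ball.
- move=> h; rewrite column_const; apply: le_sqr; rewrite ?fnorm_ge0//.
  by case: b_ball.
case=> e [e0 me ce]; apply: He; exists (e 0 0); split; first exact: me.
  apply: contrapT => ew; apply: e0; apply/matrixP => i j; rewrite !ord1 mxE.
  by apply/funext => w; apply/eqP/negPn/negP => ew0; apply: ew; exists w.
move=> h; apply: le_of_sqr; rewrite ?fnorm_ge0// DlE.
have := ce (Ut h); rewrite column_sum column_const big_ord1 fnorm_Ut.
by rewrite -(fnorm_rmul b h) -(fnorm_rmul (e 0 0) h) lerBrDl.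
Qed.

End Columns.

(** * The companion as maximal outer minorant *)

#[local] Opaque rmul lmul shift Ut inner fnorm adj.

(** Dl is the square root of 1 - b(R)^* b(R) and a0 the distance from Dl 1 to
    the vectors Dl p with p(0) = 0. Non-extremality gives a0 > 0. *)
Lemma companion_wold (R : realType) (d : option nat) (b : fseries R d) :
  unit_ball b -> ~ column_extreme (const_mx b : 'cV[fseries R d]_1) ->
  exists (Dl : fock R d -> fock R d) (a0 : R),
  [/\ positive_op Dl /\ (forall h, Dl (Dl h) = h - adj (rmul b) (rmul b h)),
      0 < a0 /\ companion0_sq b = (a0 ^+ 2)%:E,
      unit_ball (companion b) /\ outer (companion b),
      (forall h, fnorm (rmul (companion b) h) <= fnorm (Dl h)) /\
      (forall (m : nat) (f : 'I_m -> fseries R d),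
       (forall i, multiplier (f i)) ->
       (forall h, \sum_i fnorm (rmul (f i) h) ^+ 2 <= fnorm (Dl h) ^+ 2) ->
       forall h, \sum_i fnorm (rmul (f i) h) ^+ 2 <=
                 fnorm (rmul (companion b) h) ^+ 2) &
      (forall q : fock R d, q [::] = 1 -> a0 <= fnorm (Dl q)) /\
      (forall t : R, 0 < t ->
         exists2 q : fock R d, q [::] = 1 & fnorm (Dl q) <= a0 + t)].
Proof.
move=> b_ball b_nonCE.
have bB := rmul_bop (unit_ball_multiplier b_ball).
have cB := unit_ball_contractive b_ball.
pose Dl := codefect_sqrt (rmul b).
have Dl_pos : positive_op Dl := codefect_sqrt_pos bB cB.
have DlK : forall h, Dl (Dl h) = h - adj (rmul b) (rmul b h) :=
  codefect_sqrtK bB cB.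
have bDl : bounded_op Dl by case: Dl_pos.
have [e [me e0 eD]] := nonCE_minorant b_ball (fnorm_defect bB Dl_pos DlK)
  b_nonCE.
have [U [UK UD UA]] := wandering_exists Dl_pos.
have U0 : U != 0 := wandering_neq0 me e0 eD UA.
pose a0 := fnorm U.
have a0_gt0 : 0 < a0.
  by rewrite lt_def fnorm_ge0 andbT; apply: contra_neq U0; exact: fnorm_eq0.
have a0V : a0%:C * a0^-1%:C = 1 by rewrite -realcM mulfV ?lt0r_neq0.
pose u := a0^-1%:C *: U.
have u1 : fnorm u = 1.
  by rewrite fnormZ normc_real ger0_norm ?invr_ge0 ?(ltW a0_gt0)// mulVf
    ?lt0r_neq0.
have Uu : U = a0%:C *: u by rewrite scalerA a0V scale1r.
have uK : rdefect Dl u by move=> y yD; rewrite innerZr UK// mulr0.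
have uD : Dl u = a0%:C *: delta R [::].
  rewrite (bopZ bDl) UD scalerA -realcM -/a0; congr (_%:C *: _).
  by rewrite expr2 mulrA mulVf ?mul1r// lt0r_neq0.
have uA : forall t : R, 0 < t ->
    exists2 q : fock R d, q [::] = 1 & fnorm (Dl q - a0%:C *: u) <= t.
  by rewrite -Uu.
have aE := companionE b_ball a0_gt0 u1 uK uD uA.
have sqE := companion0_sqE b_ball u1 uD uA.
exists Dl, a0; split.
- exact: conj Dl_pos DlK.
- exact: conj a0_gt0 sqE.
- rewrite aE; split.
    exact: (wold_unit_ball _ _ _ _ u1 uD uA).
  exact: (wold_outer _ _ _ _ a0_gt0 u1 uK uD uA).
- rewrite aE; split.
    move=> h; exact: (rmul_wold_le _ _ _ _ u1 uD uA).
  move=> m f mf; exact: (wold_maximal _ _ _ _ u1 uD uA mf).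
split; first exact: (wold_inf Dl_pos a0_gt0 u1 uD).
move=> t t0; have [q q1 Hq] := UA _ t0; exists q => //.
have := ler_fnormD (Dl q - U) U; rewrite subrK => /le_trans; apply.
by rewrite addrC lerD2l.
Qed.

Theorem mainTheorem1 (R : realType) (d : option nat) (b : fseries R d)
    (b_ball : unit_ball b)
    (b_nonCE : ~ column_extreme (const_mx b : 'cV[fseries R d]_1)) :
  let a := companion b in
  let one : fock R d := to_fock (@monomial R d [::]) in
  [/\ (0 < companion0_sq b)%E,
      unit_ball a,
      outer a,
      left_toeplitz (adj (rmul a) \o rmul a)
        /\ maximal_factorable_minorant (codefect b) (adj (rmul a) \o rmul a) &
      column_extreme (col_mx (const_mx b : 'cV[fseries R d]_1)
                             (const_mx a : 'cV[fseries R d]_1))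
        /\ complex.Re (a [::]) ^+ 2 =
           inf [set complex.Re (inner (one - p) (codefect b (one - p)))
                 | p in [set p : fock R d | free_poly0 p]] ].
Proof.
move=> a one.
have [mb bb] := b_ball; have bB := rmul_bop mb.
have [Dl [a0 [[Dl_pos DlK] [a0_gt0 sqE] [ua oa] [a_le a_max] [a0_le a0_near]]]]
  :=
  companion_wold b_ball b_nonCE.
have aa0 : complex.Re (a [::]) = a0.
  by rewrite /a /companion sqE /= sqrtr_sqr ger0_norm ?ltW.
rewrite -/a in ua oa a_le a_max; clearbody a.
have [ma _] := ua; have ba := rmul_bop ma.
have [bDl _] := Dl_pos; have sDl := positive_sa Dl_pos.
have DlE := fnorm_defect bB Dl_pos DlK.
have inner_codefect h : inner h (codefect b h) = (fnorm (Dl h) ^+ 2)%:C.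
  by rewrite /codefect -DlK -sDl inner_ff.
have inner_gram (f : fseries R d) h : multiplier f ->
    inner h (adj (rmul f) (rmul f h)) = (fnorm (rmul f h) ^+ 2)%:C.
  by move=> mf; rewrite (adjPr (rmul_bop mf)) inner_ff.
split=> //; first by rewrite sqE lte_fin exprn_gt0.
- split.
    split; first exact: bop_comp (adj_bop ba) ba.
    move=> j k h; apply: inner_ext => f;
      rewrite (adjPr (shift_bop R j)) innerZr.
    rewrite /comp !(adjPr ba) (rmul_shift j f ma) (rmul_shift k h ma).
    by rewrite -(adjPr (shift_bop R j)) adj_shift_shift innerZr.
  split.
    exists a; split=> // h; rewrite inner_codefect /comp (inner_gram a h ma)
      lecR.
    exact: le_sqr (fnorm_ge0 _) (a_le h).
  move=> N [f [[mf _] -> fD]] h;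
    rewrite /comp (inner_gram f h mf) (inner_gram a h ma) lecR.
  have f_le g : \sum_(i < 1) fnorm (rmul f g) ^+ 2 <= fnorm (Dl g) ^+ 2.
    rewrite (big_ord1 _ (fun=> fnorm (rmul f g) ^+ 2)).
    by have := fD g; rewrite inner_codefect /comp (inner_gram f g mf) lecR.
  have := a_max 1%N (fun=> f) (fun=> mf) f_le h.
  by rewrite (big_ord1 _ (fun=> fnorm (rmul f h) ^+ 2)).
split; last first.
  rewrite aa0; set S := [set _ | _ in _].
  have SE p : complex.Re (inner (one - p) (codefect b (one - p))) =
      fnorm (Dl (one - p)) ^+ 2 by rewrite inner_codefect.
  have S0 : S !=set0.
    exists (complex.Re (inner (one - 0) (codefect b (one - 0)))), 0 => //;
      split=> //.
    rewrite (_ : [set w | _] = set0); first exact: finite_set0.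
    by rewrite predeqE => w; split=> //=; rewrite eqxx.
  have Slb : lbound S (a0 ^+ 2).
    move=> _ [p [_ p0] <-]; rewrite SE; apply: le_sqr; first exact: ltW.
    by apply: a0_le; rewrite coefB p0 subr0 deltaE eqxx.
  apply/eqP; rewrite eq_le; apply/andP; split; first exact: lb_le_inf.
  apply: le_sqr_approx => [|t t0]; first exact: ltW.
  have t20 : 0 < t / 2 by rewrite divr_gt0.
  have [q q1 Hq] := a0_near _ t20.
  (* Replace the near-minimizer 1 - q by a polynomial without constant term. *)
  have [s us /ltW Hs] := @cutoff_near R d (one - q) _ t20.
  set p := cutoff s (one - q) in Hs.
  have pP : free_poly0 p.
    split; last by rewrite cutoffE// coefB q1 deltaE eqxx subrr; case: ifP.
    apply: sub_finite_set (finite_seq s) => w /=.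
    by rewrite cutoffE//; case: ifP => //; rewrite eqxx.
  apply: (@le_trans _ _ (fnorm (Dl (one - p)) ^+ 2)).
    by rewrite -SE; apply: ge_inf; [exists (a0 ^+ 2)|exists p].
  apply: le_sqr; first exact: fnorm_ge0.
  have -> : Dl (one - p) = Dl q + Dl (one - q - p).
    by rewrite -(bopD bDl); congr Dl; rewrite addrA [q + _]addrC subrK.
  apply: le_trans (ler_fnormD _ _) _.
  apply: (@le_trans _ _ (a0 + t / 2 + t / 2)); last by lra.
  apply: lerD => //; apply: le_trans Hs.
  exact: (defect_contractive bB Dl_pos DlK).
have col_ba h : fnorm (lmul b h) ^+ 2 + fnorm (lmul a h) ^+ 2 <= fnorm h ^+ 2.
  rewrite (fnorm_lmul b) (fnorm_lmul a) -[leRHS](congr1 (fun x =>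
    x ^+ 2) (fnorm_Ut h)).
  by have := le_sqr (fnorm_ge0 _) (a_le (Ut h)); rewrite DlE lerBrDl.
split.
- exact: (col_mx_multiplier (const_col_multiplier mb) (const_col_multiplier
  ma)).
- by move=> h; apply: le_trans (col_ba h); rewrite column_const_pair.
case=> f [f0 mf cf]; apply: f0.
(* By maximality, the column of a(R) and f(R) is dominated by a(R) alone. *)
pose F : 'cV[fseries R d]_(1 + (1 + 1)) := col_mx (const_mx a : 'cV[fseries R
  d]_1) f.
have sumF h : \sum_i fnorm (rmul (F i 0) h) ^+ 2 =
    fnorm (rmul a h) ^+ 2 + \sum_i fnorm (rmul (f i 0) h) ^+ 2.
  rewrite (sum_col_mx _ f (fun G => fnorm (rmul G h) ^+ 2)) big_ord1 mxE.
  by [].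
have HF h : \sum_i fnorm (rmul (F i 0) h) ^+ 2 <= fnorm (rmul a h) ^+ 2.
  apply: (a_max _ (fun i => F i 0)) => [i|g].
    exact: (col_mx_multiplier (const_col_multiplier ma) mf).
  rewrite sumF DlE lerBrDl addrA.
  have := cf (Ut g); rewrite column_sum column_const_pair fnorm_Ut.
  rewrite -(fnorm_rmul b) -(fnorm_rmul a).
  by under [X in _ + X <= _ -> _]eq_bigr do rewrite -fnorm_rmul.
apply/matrixP => i j; rewrite ord1 mxE; apply/funext => w.
have := HF (delta R [::]); rewrite sumF gerDl => f0.
have fi0 : fnorm (rmul (f i 0) (delta R [::])) ^+ 2 = 0.
  apply/eqP; rewrite eq_le exprn_ge0 ?fnorm_ge0// andbT; apply: le_trans f0.
  by rewrite (bigD1 i)//= lerDl sumr_ge0// => k _; rewrite exprn_ge0 ?fnorm_ge0.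
have /fnorm_eq0 fi : fnorm (rmul (f i 0) (delta R [::])) = 0.
  by apply/eqP; rewrite -sqrf_eq0 fi0.
by have := rmul_delta0 (rev w) (mf i); rewrite fi /transpose revK => <-.
Qed.
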